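(* Let $k,p\in\mathbb{N}$, $s\in\mathbb{N}_0$, $Y_s=\{y_i\}_{i=1}^s$ with $-1<y_s<\dots<y_1<1$ (empty if $s=0$), $A_p=\{\alpha_i\}_{i=1}^p$ with $-1\le\alpha_p<\dots<\alpha_1\le1$, $Y_s\cap A_p=\emptyset$, and $$(r,m_1,m_2,m_3)\in\{(2j,2j-1,2j-2,2j-1): j\in\mathbb{N}\}\cup\{(2j+1,2j-1,2j,2j): j\in\mathbb{N}_0\}.$$ Let $f\in C^r[-1,1]$ and let $Z_n=\{z_j\}_{j=0}^n$, $-1=z_n<z_{n-1}<\dots<z_1<z_0=1$, be a knot sequence such that each nonempty open interval $(\beta_j,\beta_{j-1})$, $1\le j\le s+p+1$, contains at least $4(k+r-1)^2$ knots, where $Y_s\cup A_p=\{\beta_j\}_{j=1}^{s+p}$ with $\beta_{s+p}<\dots<\beta_1$, $\beta_0=1$, $\beta_{s+p+1}=-1$. Then there exists $S\in\Sigma_{k+r}(Z_n)\cap C^{k+r-2}[-1,1]$ such that $S-f\in\Delta^{(0)}(Y_s)$, $S^{(i)}(\alpha)=f^{(i)}(\alpha)$ for $\alpha\in A_p$, $0\le i\le m_1$ (vacuous if $m_1=-1$), $S^{(i)}(y)=f^{(i)}(y)$ for $y\in Y_s$, $0\le i\le m_2$, $S^{(i)}(\pm1)=f^{(i)}(\pm1)$ for $0\le i\le m_3$, and, for $0\le i\le n-1$, $$\|f-S\|_{C(J_i)}\le c\,|J_i|^r\,\omega_k(f^{(r)},|\widehat J_i|;\widehat J_i),\qquad c=c(k,r,\rho),$$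 where $\widehat J_i$ is an interval with $J_i\subset\widehat J_i\subseteq[z_{i+6(k+r-1)^2},z_{i-6(k+r-1)^2}]$.
   Context: Set $z_i:=-1$ for $i>n$, $z_i:=1$ for $i<0$, $J_i:=[z_i,z_{i-1}]$, and $\rho:=\max\{|J_{i\pm1}|/|J_i|: 1\le i\le n\}$. $\Sigma_m(Z_n)$ denotes the set of continuous piecewise polynomial functions on $[-1,1]$ which are polynomials of degree $\le m-1$ on each $[z_j,z_{j-1}]$. $\omega_k(g,t;J)$ is the $k$-th modulus of smoothness of $g$ on the interval $J$. With $y_0:=1$, $y_{s+1}:=-1$, $h\in\Delta^{(0)}(Y_s)$ iff $(-1)^ih\ge0$ on $[y_{i+1},y_i]$ for $0\le i\le s$ (for $s=0$ this means $h\ge0$ on $[-1,1]$). *)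

(* Defs.v *)
From Stdlib Require Import Reals Lra Lia ZArith List.
From Coquelicot Require Import Coquelicot.
Open Scope R_scope.

Definition deriv_within (a b : R) (g : R -> R) (x l : R) : Prop :=
  filterlim (fun y => (g y - g x) / (y - x))
    (within (fun y => a <= y <= b /\ y <> x) (locally x)) (locally l).

Definition cont_within (a b : R) (g : R -> R) (x : R) : Prop :=
  filterlim g (within (fun y => a <= y <= b) (locally x)) (locally (g x)).

Definition Cr_derivs (a b : R) (r : nat) (g : R -> R) (D : nat -> R -> R) : Prop :=
  (forall x, a <= x <= b -> D 0%nat x = g x) /\
  (forall i : nat, (i < r)%nat ->
     forall x, a <= x <= b -> deriv_within a b (D i) x (D (S i) x)) /\
  (forall x, a <= x <= b -> cont_within a b (D r) x).

Definition zext (z : nat -> R) (n : nat) (i : Z) : R :=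
  if (i <? 0)%Z then 1
  else if (Z.of_nat n <? i)%Z then -1
  else z (Z.to_nat i).

Definition knot_seq (z : nat -> R) (n : nat) : Prop :=
  z 0%nat = 1 /\ z n = -1 /\ (forall j : nat, (j < n)%nat -> z (S j) < z j).

Definition Jlen (z : nat -> R) (n : nat) (i : Z) : R :=
  zext z n (i - 1) - zext z n i.

Definition rho (z : nat -> R) (n : nat) : R :=
  fold_right Rmax 0
    (map (fun j : nat =>
            let i := Z.of_nat j in
            Rmax (Jlen z n (i - 1) / Jlen z n i) (Jlen z n (i + 1) / Jlen z n i))
         (seq 1 n)).

Definition knots_in (z : nat -> R) (n : nat) (a b : R) : nat :=
  length (filter (fun j => if Rlt_dec a (z j) then
                             if Rlt_dec (z j) b then true else false
                           else false) (seq 0 (S n))).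

Definition peval (cs : list R) (x : R) : R :=
  fold_right (fun c acc => c + x * acc) 0 cs.

Definition Sigma (m : nat) (z : nat -> R) (n : nat) (S : R -> R) : Prop :=
  (forall x, -1 <= x <= 1 -> cont_within (-1) 1 S x) /\
  (forall j : nat, (1 <= j <= n)%nat ->
     exists cs : list R, (length cs <= m)%nat /\
       forall x, z j <= x <= z (Nat.pred j) -> S x = peval cs x).

Definition fdiff (k : nat) (h : R) (g : R -> R) (x : R) : R :=
  sum_f_R0 (fun l => (-1) ^ (k - l) * Binomial.C k l * g (x + INR l * h)) k.

Definition omega (k : nat) (g : R -> R) (t a b : R) : R :=
  real (Lub_Rbar (fun v => exists h x, 0 < h <= t /\ a <= x /\ x + INR k * h <= b
                                   /\ v = Rabs (fdiff k h g x))).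

Definition yext (y : nat -> R) (s : nat) (i : nat) : R :=
  if Nat.eqb i 0 then 1 else if Nat.eqb i (S s) then -1 else y i.

Definition Delta0 (y : nat -> R) (s : nat) (h : R -> R) : Prop :=
  forall i : nat, (i <= s)%nat ->
    forall x, yext y s (S i) <= x <= yext y s i -> 0 <= (-1) ^ i * h x.

(* Main.v *)
Require Import Defs.
From Stdlib Require Import Reals Lra Lia ZArith List FunctionalExtensionality ClassicalEpsilon.
From Coquelicot Require Import Coquelicot.
Open Scope R_scope.

(** With [e = k + r - 1], the spline is a B-spline series of degree [e] on the given knots
    (repeated at the endpoints), whose j-th coefficient is that of a locally chosen polynomial.
    If the closed support of the j-th B-spline contains a point [v] of Y, A or {-1, 1} (at most
    one, because many knots separate these points), that polynomial interpolates [f] at [v] and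
    lies on the required side of [f]: to a Taylor polynomial with a Whitney remainder of size
    [w |x - v|^r] one adds a multiple of [w (x - v)^r] or [w (x - v)^(r-1)], according to the
    parity that makes the difference change, or keep, its sign at [v].  Otherwise it is a local
    Whitney polynomial shifted by a large multiple of its error bound in the required direction.
    On a knot interval the spline is a convex combination of its e + 1 local coefficients, so it
    suffices to compare these with the coefficients of one reference polynomial: the one
    attached to [v] if such a coefficient is present, and the local polynomial with the smallest
    error bound if not.  The modulus of smoothness on neighbouring windows need not be
    comparable; the choice of the smallest bound is what makes this harmless. *)

(** * Polynomials *)

(** The obstacle is one-sidedness. A B-spline coefficient, as a functional of the polynomial, is
    bounded but not positive, so an inequality between polynomials gives none between their
    coefficients. Only a shift exceeding the norm of the functional times the local error puts the
    coefficients in order. A shift would destroy interpolation, so the coefficients touching a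
    breakpoint stay unshifted; this is harmless because nearby ones all come from one polynomial
    that is already one-sided. Interpolation is then free: on a knot interval containing [v] every
    B-spline touches [v], so the spline coincides there with the polynomial of [v]. The number of
    matched derivatives is the even one of r - 1 and r at points of A, the odd one at points of Y;
    at 1 and -1 only one side exists, so r is always admissible. The mesh ratio enters twice: it
    places the knots of a coefficient within a bounded multiple of the reference interval, and it
    bounds the length of a window by that of J_i. Knots decrease with their index throughout, and
    [zext] repeats the endpoints indefinitely. *)

Lemma is_derive_ext_R (f g : R -> R) (x l : R) :
  (forall u, f u = g u) -> is_derive f x l -> is_derive g x l.
Proof. intros H; apply is_derive_ext, H. Qed.

(** [m] is the order, one more than the degree bound, as in [Sigma]; order 0 contains only the zero
    function, which starts the inductions. *)
Definition is_poly (m : nat) (f : R -> R) : Prop :=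
  exists cs : list R, (length cs <= m)%nat /\ forall x, f x = peval cs x.

Lemma is_poly_zero m : is_poly m (fun _ => 0).
Proof. exists nil; split; [simpl; lia | reflexivity]. Qed.

Lemma is_poly_0_inv f : is_poly 0 f -> forall x, f x = 0.
Proof.
  intros [[|c cs] [Hl Hf]] x; [now rewrite Hf | simpl in Hl; lia].
Qed.

Lemma is_poly_ext m f g : (forall x, f x = g x) -> is_poly m f -> is_poly m g.
Proof.
  intros H [cs [Hl Hf]]; exists cs; split; [exact Hl | intros x; now rewrite <- H].
Qed.

Lemma is_poly_le m m' f : (m <= m')%nat -> is_poly m f -> is_poly m' f.
Proof. intros H [cs [Hl Hf]]; exists cs; split; [lia | exact Hf]. Qed.

Lemma is_poly_S_inv m f : is_poly (S m) f ->
  exists c g, is_poly m g /\ forall x, f x = c + x * g x.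
Proof.
  intros [[|c cs] [Hl Hf]].
  - exists 0, (fun _ => 0); split; [apply is_poly_zero|].
    intros x; rewrite Hf; simpl; ring.
  - exists c, (peval cs); split; [exists cs; split; [simpl in Hl; lia | easy] |].
    intros x; now rewrite Hf.
Qed.

Lemma is_poly_S_intro m c g : is_poly m g -> is_poly (S m) (fun x => c + x * g x).
Proof.
  intros [cs [Hl Hf]]; exists (c :: cs); split; [simpl; lia|].
  intros x; simpl; now rewrite Hf.
Qed.

Lemma is_poly_plus m f g : is_poly m f -> is_poly m g -> is_poly m (fun x => f x + g x).
Proof.
  revert f g; induction m as [|m IH]; intros f g Hf Hg.
  - apply is_poly_ext with (fun _ => 0); [|apply is_poly_zero].
    intros x; rewrite (is_poly_0_inv _ Hf), (is_poly_0_inv _ Hg); ring.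
  - destruct (is_poly_S_inv _ _ Hf) as [c [f1 [Hf1 Ef]]].
    destruct (is_poly_S_inv _ _ Hg) as [d [g1 [Hg1 Eg]]].
    apply is_poly_ext with (fun x => (c + d) + x * (f1 x + g1 x)).
    + intros x; rewrite Ef, Eg; ring.
    + apply is_poly_S_intro, IH; assumption.
Qed.

Lemma is_poly_scal m a f : is_poly m f -> is_poly m (fun x => a * f x).
Proof.
  revert f; induction m as [|m IH]; intros f Hf.
  - apply is_poly_ext with (fun _ => 0); [|apply is_poly_zero].
    intros x; rewrite (is_poly_0_inv _ Hf); ring.
  - destruct (is_poly_S_inv _ _ Hf) as [c [f1 [Hf1 Ef]]].
    apply is_poly_ext with (fun x => a * c + x * (a * f1 x)).
    + intros x; rewrite Ef; ring.
    + apply is_poly_S_intro, IH; assumption.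
Qed.

Lemma is_poly_minus m f g : is_poly m f -> is_poly m g -> is_poly m (fun x => f x - g x).
Proof.
  intros Hf Hg; apply is_poly_ext with (fun x => f x + (-1) * g x); [intros; ring|].
  apply is_poly_plus; [|apply is_poly_scal]; assumption.
Qed.

Lemma is_poly_const m c : is_poly (S m) (fun _ => c).
Proof.
  apply is_poly_ext with (fun x => c + x * 0); [intros; ring|].
  apply is_poly_S_intro, is_poly_zero.
Qed.

Lemma is_poly_mul_affine m a b f : is_poly m f -> is_poly (S m) (fun x => (a + b * x) * f x).
Proof.
  intros Hf; apply is_poly_ext with (fun x => a * f x + (0 + x * (b * f x))); [intros; ring|].
  apply is_poly_plus.
  - apply is_poly_scal, is_poly_le with m; [lia | exact Hf].
  - apply (is_poly_S_intro m 0 (fun x => b * f x)), is_poly_scal, Hf.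
Qed.

Lemma is_poly_comp_affine m a b f : is_poly m f -> is_poly m (fun x => f (a + b * x)).
Proof.
  revert f; induction m as [|m IH]; intros f Hf.
  - apply is_poly_ext with (fun _ => 0); [|apply is_poly_zero].
    intros x; now rewrite (is_poly_0_inv _ Hf).
  - destruct (is_poly_S_inv _ _ Hf) as [c [f1 [Hf1 Ef]]].
    apply is_poly_ext with (fun x => c + (a + b * x) * f1 (a + b * x)).
    + intros x; now rewrite Ef.
    + apply (is_poly_plus (S m) (fun _ => c)); [apply is_poly_const|].
      apply (is_poly_mul_affine m a b (fun x => f1 (a + b * x))), IH, Hf1.
Qed.

Lemma is_poly_pow n a : is_poly (S n) (fun x => (x - a) ^ n).
Proof.
  induction n as [|n IH]; [apply (is_poly_const 0 1)|].
  apply is_poly_ext with (fun x => (- a + 1 * x) * (x - a) ^ n); [intros; simpl; ring|].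
  apply is_poly_mul_affine, IH.
Qed.

Lemma is_poly_derive m f : is_poly (S m) f ->
  exists f', is_poly m f' /\ forall x : R, is_derive f x (f' x).
Proof.
  revert f; induction m as [|m IH]; intros f Hf;
    destruct (is_poly_S_inv _ _ Hf) as [c [f1 [Hf1 Ef]]].
  - exists (fun _ => 0); split; [apply is_poly_zero|].
    intros x; apply is_derive_ext_R with (fun _ => c).
    + intros u; rewrite Ef, (is_poly_0_inv _ Hf1); ring.
    + apply (is_derive_const (V := R_NormedModule)).
  - destruct (IH _ Hf1) as [g [Hg Dg]].
    exists (fun x => f1 x + (0 + x * g x)); split.
    + apply is_poly_plus; [exact Hf1 | apply is_poly_S_intro, Hg].
    + intros x; apply is_derive_ext_R with (fun u => c + u * f1 u); [intros; now rewrite Ef|].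
      specialize (Dg x); auto_derive; [now exists (g x)|].
      replace (Derive (fun u : R => f1 u) x) with (g x)
        by (symmetry; apply is_derive_unique, Dg); ring.
Qed.

Lemma is_poly_ex_derive m f x : is_poly m f -> ex_derive f x.
Proof.
  intros Hf; destruct (is_poly_derive m f) as [f' [_ D]].
  - apply is_poly_le with m; [lia | exact Hf].
  - exists (f' x); apply D.
Qed.

Lemma is_poly_Derive m f : is_poly (S m) f -> is_poly m (Derive f).
Proof.
  intros Hf; destruct (is_poly_derive m f Hf) as [f' [Hf' D]].
  apply is_poly_ext with f'; [|exact Hf'].
  intros x; symmetry; apply is_derive_unique, D.
Qed.

Lemma is_poly_Derive_weak m f : is_poly m f -> is_poly m (Derive f).
Proof.
  intros Hf; apply is_poly_Derive, is_poly_le with m; [lia | exact Hf].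
Qed.

Lemma is_poly_Derive_n m f l : is_poly m f -> is_poly m (Derive_n f l).
Proof.
  intros Hf; induction l as [|l IH]; [exact Hf|].
  simpl; apply is_poly_Derive_weak, IH.
Qed.

Lemma is_poly_continuous m f (x : R) : is_poly m f -> continuous f x.
Proof.
  intros Hf; apply (ex_derive_continuous (K := R_AbsRing) (V := R_NormedModule)).
  apply (is_poly_ex_derive m), Hf.
Qed.

Lemma is_poly_primitive m f tau v : is_poly m f ->
  exists F, is_poly (S m) F /\ F tau = v /\ forall x : R, is_derive F x (f x).
Proof.
  intros Hf.
  (* Peeling off the constant term leaves a factor [x], so the induction carries a weight [x ^ s]
     whose primitive is [x ^ (S s)] times a polynomial of the same order. *)
  assert (H : forall m s f, is_poly m f -> exists H, is_poly m H /\
    forall x : R, is_derive (fun u => u ^ (S s) * H u) x (x ^ s * f x)).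
  { clear; induction m as [|m IH]; intros s f Hf.
    - exists (fun _ => 0); split; [apply is_poly_zero|].
      intros x; apply is_derive_ext_R with (fun _ => 0); [intros; ring|].
      rewrite (is_poly_0_inv _ Hf), Rmult_0_r.
      apply (is_derive_const (V := R_NormedModule)).
    - destruct (is_poly_S_inv _ _ Hf) as [c [f1 [Hf1 Ef]]].
      destruct (IH (S s) f1 Hf1) as [H1 [PH1 D1]].
      exists (fun x => c / INR (S s) + x * H1 x); split; [now apply is_poly_S_intro|].
      intros x.
      apply is_derive_ext_R with
        (fun u => c / INR (S s) * u ^ (S s) + (u ^ (S (S s)) * H1 u)); [intros; simpl; ring|].
      replace (x ^ s * f x) with (c * x ^ s + x ^ (S s) * f1 x) by (rewrite Ef; simpl; ring).
      apply (is_derive_plus (V := R_NormedModule)); [|apply D1].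
      assert (Hs : INR (S s) <> 0) by (apply not_0_INR; lia).
      auto_derive; [easy|].
      change (Nat.pred (S s)) with s; field; exact Hs. }
  destruct (H m 0%nat f Hf) as [H1 [P1 D1]].
  exists (fun x => (v - tau * H1 tau) + x * H1 x); split; [now apply is_poly_S_intro|].
  split; [ring|].
  intros x.
  apply is_derive_ext_R with (fun u => (v - tau * H1 tau) + u ^ 1 * H1 u); [intros; ring|].
  replace (f x) with (0 + x ^ 0 * f x) by (simpl; ring).
  apply (is_derive_plus (V := R_NormedModule)); [|apply D1].
  apply (is_derive_const (V := R_NormedModule)).
Qed.

Lemma is_poly_factor m f a : is_poly (S m) f ->
  exists g, is_poly m g /\ forall x, f x = f a + (x - a) * g x.
Proof.
  revert f; induction m as [|m IH]; intros f Hf;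
    destruct (is_poly_S_inv _ _ Hf) as [c [f1 [Hf1 Ef]]].
  - exists (fun _ => 0); split; [apply is_poly_zero|].
    intros x; rewrite !Ef, !(is_poly_0_inv _ Hf1); ring.
  - destruct (IH _ Hf1) as [g [Hg Eg]].
    exists (fun x => f1 a + x * g x); split; [now apply is_poly_S_intro|].
    intros x; rewrite !Ef, (Eg x); ring.
Qed.

(* Both bounds are by induction on the order: write [f = f a + (x - a) g], where [g] is
   bounded by [4 M / h] on the half of the interval away from [a]. *)
Lemma is_poly_quotient_bound m f a h M : 0 < h -> is_poly (S m) f ->
  (forall x, a <= x <= a + h -> Rabs (f x) <= M) ->
  exists g, is_poly m g /\ (forall x, f x = f a + (x - a) * g x) /\
    forall x, a + h / 2 <= x <= a + h / 2 + h / 2 -> Rabs (g x) <= 4 * M / h.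
Proof.
  intros Hh Hf HM; destruct (is_poly_factor m f a Hf) as [g [Hg Eg]].
  exists g; split; [exact Hg | split; [exact Eg|]].
  intros x Hx.
  assert (H1 : Rabs ((x - a) * g x) <= 2 * M).
  { replace ((x - a) * g x) with (f x - f a) by (rewrite (Eg x); ring).
    apply Rle_trans with (Rabs (f x) + Rabs (f a)).
    - unfold Rminus; rewrite <- (Rabs_Ropp (f a)); apply Rabs_triang.
    - assert (Rabs (f x) <= M) by (apply HM; lra).
      assert (Rabs (f a) <= M) by (apply HM; lra). lra. }
  rewrite Rabs_mult, (Rabs_pos_eq (x - a)) in H1 by lra.
  apply Rmult_le_reg_l with (h / 2); [lra|].
  replace (h / 2 * (4 * M / h)) with (2 * M) by (field; lra).
  apply Rle_trans with (2 := H1), Rmult_le_compat_r; [apply Rabs_pos | lra].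
Qed.

Lemma poly_growth m K : 0 <= K -> exists C, 0 <= C /\ forall f a h M, 0 < h -> is_poly m f ->
  (forall x, a <= x <= a + h -> Rabs (f x) <= M) ->
  forall x, Rabs (x - a) <= K * h -> Rabs (f x) <= C * M.
Proof.
  revert K; induction m as [|m IH]; intros K HK.
  - exists 0; split; [lra|]; intros f a h M Hh Hf HM x _.
    rewrite (is_poly_0_inv _ Hf), Rabs_R0; lra.
  (* Passing to the right half moves the base point by h/2 and halves the length: a distance K h
     becomes at most K h + h/2 = (2K + 1)(h/2). *)
  - destruct (IH (2 * K + 1)) as [C [HC H]]; [lra|].
    exists (1 + 4 * K * C); split; [nra|].
    intros f a h M Hh Hf HM x Hx.
    destruct (is_poly_quotient_bound m f a h M Hh Hf HM) as [g [Hg [Eg Bg]]].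
    assert (HfM : Rabs (f a) <= M) by (apply HM; lra).
    assert (HgM : Rabs (g x) <= C * (4 * M / h)).
    { apply (H g (a + h / 2) (h / 2)); [lra | exact Hg | exact Bg |].
      replace (x - (a + h / 2)) with ((x - a) + - (h / 2)) by ring.
      apply Rle_trans with (1 := Rabs_triang _ _).
      rewrite Rabs_Ropp, (Rabs_pos_eq (h / 2)) by lra; lra. }
    rewrite Eg; apply Rle_trans with (1 := Rabs_triang _ _); rewrite Rabs_mult.
    assert (Rabs (x - a) * Rabs (g x) <= (K * h) * (C * (4 * M / h)))
      by (apply Rmult_le_compat; auto using Rabs_pos).
    replace ((K * h) * (C * (4 * M / h))) with (4 * K * C * M) in H0 by (field; lra).
    lra.
Qed.

Lemma poly_markov m : exists C, 0 <= C /\ forall f a h M, 0 < h -> is_poly m f ->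
  (forall x, a <= x <= a + h -> Rabs (f x) <= M) ->
  forall x, a <= x <= a + h -> Rabs (Derive f x) <= C * M / h.
Proof.
  (* The quotient is controlled only on the right half, while the derivative is wanted on the whole
     interval; the induction must therefore allow points outside the interval of control. *)
  assert (H : forall K, 0 <= K -> exists C, 0 <= C /\ forall f a h M, 0 < h -> is_poly m f ->
    (forall x, a <= x <= a + h -> Rabs (f x) <= M) ->
    forall x, Rabs (x - a) <= K * h -> Rabs (Derive f x) <= C * M / h).
  { induction m as [|m IH]; intros K HK.
    - exists 0; split; [lra|]; intros f a h M Hh Hf HM x _.
      rewrite (is_poly_0_inv _ (is_poly_Derive_weak _ _ Hf)), Rabs_R0; unfold Rdiv; lra.
    - destruct (IH (2 * K + 1)) as [C [HC H]]; [lra|].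
      destruct (poly_growth m (2 * K + 1)) as [C' [HC' H']]; [lra|].
      exists (4 * C' + 8 * K * C); split; [nra|].
      intros f a h M Hh Hf HM x Hx.
      destruct (is_poly_quotient_bound m f a h M Hh Hf HM) as [g [Hg [Eg Bg]]].
      assert (HM0 : 0 <= M) by (apply Rle_trans with (1 := Rabs_pos (f a)), HM; lra).
      assert (Hx' : Rabs (x - (a + h / 2)) <= (2 * K + 1) * (h / 2)).
      { replace (x - (a + h / 2)) with ((x - a) + - (h / 2)) by ring.
        apply Rle_trans with (1 := Rabs_triang _ _).
        rewrite Rabs_Ropp, (Rabs_pos_eq (h / 2)) by lra; lra. }
      assert (B1 : Rabs (g x) <= C' * (4 * M / h))
        by (apply (H' g (a + h / 2) (h / 2)); auto; lra).
      assert (B2 : Rabs (Derive g x) <= C * (4 * M / h) / (h / 2))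
        by (apply (H g (a + h / 2) (h / 2)); auto; lra).
      assert (E : Derive f x = g x + (x - a) * Derive g x).
      { rewrite (Derive_ext f _ x Eg).
        apply is_derive_unique.
        assert (Dg := is_poly_ex_derive m g x Hg).
        auto_derive; [exact Dg|].
        change (Derive (fun u : R => g u) x) with (Derive g x); ring. }
      rewrite E; apply Rle_trans with (1 := Rabs_triang _ _); rewrite Rabs_mult.
      assert (Rabs (x - a) * Rabs (Derive g x) <= (K * h) * (C * (4 * M / h) / (h / 2)))
        by (apply Rmult_le_compat; auto using Rabs_pos).
      replace ((4 * C' + 8 * K * C) * M / h) with
        (C' * (4 * M / h) + (K * h) * (C * (4 * M / h) / (h / 2))) by (field; lra).
      lra. }
  destruct (H 1) as [C [HC H1]]; [lra|].
  exists C; split; [exact HC|].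
  intros f a h M Hh Hf HM x Hx; apply (H1 f a h M); auto.
  rewrite Rabs_pos_eq; lra.
Qed.

Lemma Derive_n_S_l f n x : Derive_n f (S n) x = Derive_n (Derive f) n x.
Proof.
  revert x; induction n as [|n IH]; intros x; [reflexivity|].
  change (Derive (Derive_n f (S n)) x = Derive (Derive_n (Derive f) n) x).
  apply Derive_ext, IH.
Qed.

(** Mean value theorem: the intermediate point is no farther from [tau] than [x]. The factor 1/(s +
    1) of exact integration is given up. *)
Lemma abs_le_of_derive (u v : R -> R) (lo hi tau A : R) s : 0 <= A -> lo <= tau <= hi ->
  (forall x : R, continuous u x) -> (forall x : R, lo < x < hi -> is_derive u x (v x)) ->
  u tau = 0 -> (forall x, lo <= x <= hi -> Rabs (v x) <= A * Rabs (x - tau) ^ s) ->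
  forall x, lo <= x <= hi -> Rabs (u x) <= A * Rabs (x - tau) ^ S s.
Proof.
  intros HA Htau Cu Du Hu Hv x Hx.
  destruct (MVT_gen u tau x v) as [c [Hc E]].
  - intros w Hw; apply Du; revert Hw; unfold Rmin, Rmax; destruct (Rle_dec tau x); lra.
  - intros w _; apply continuity_pt_filterlim, Cu.
  - rewrite Hu, Rminus_0_r in E; rewrite E, Rabs_mult.
    assert (Hc' : lo <= c <= hi /\ Rabs (c - tau) <= Rabs (x - tau)).
    { revert Hc; unfold Rmin, Rmax; destruct (Rle_dec tau x); intros Hc; (split; [lra|]).
      - rewrite !Rabs_pos_eq; lra.
      - rewrite !Rabs_left1; lra. }
    simpl; rewrite (Rmult_comm (Rabs (x - tau)) (_ ^ s)), <- Rmult_assoc.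
    apply Rmult_le_compat_r; [apply Rabs_pos|].
    apply Rle_trans with (1 := Hv c (proj1 Hc')).
    apply Rmult_le_compat_l; [exact HA|].
    apply pow_incr; split; [apply Rabs_pos | apply Hc'].
Qed.

(** Integrate the approximant [Q] of the top derivative r times from [tau], with the values
    [E l tau] as constants of integration; each integration gains one power of the distance to
    [tau]. Differentiability is asked for only in the open interval, so that functions extended by
    constants beyond [-1, 1] qualify. *)
Lemma taylor_poly r m (E : nat -> R -> R) (lo hi tau : R) (Q : R -> R) (A : R) :
  lo <= tau <= hi ->
  (forall (i : nat) (x : R), (i <= r)%nat -> continuous (E i) x) ->
  (forall (i : nat) (x : R), (i < r)%nat -> lo < x < hi -> is_derive (E i) x (E (S i) x)) ->
  is_poly m Q -> 0 <= A -> (forall x, lo <= x <= hi -> Rabs (E r x - Q x) <= A) ->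
  exists P, is_poly (m + r) P /\ (forall l, (l < r)%nat -> Derive_n P l tau = E l tau) /\
    forall x, lo <= x <= hi -> Rabs (E 0%nat x - P x) <= A * Rabs (x - tau) ^ r.
Proof.
  intros Htau; revert E; induction r as [|r IH]; intros E CE DE HQ HA HE.
  - exists Q; split; [now rewrite Nat.add_0_r|]; split; [lia|].
    intros x Hx; simpl; rewrite Rmult_1_r; now apply HE.
  - destruct (IH (fun i => E (S i))) as [P1 [HP1 [DP1 BP1]]]; auto.
    + intros; apply CE; lia.
    + intros; apply DE; [lia | assumption].
    + destruct (is_poly_primitive (m + r) P1 tau (E 0%nat tau) HP1) as [P [HP [EP DP]]].
      exists P; split; [now rewrite Nat.add_succ_r|]; split.
      * intros [|l] Hl; [exact EP|].
        rewrite Derive_n_S_l, (Derive_n_ext (Derive P) P1);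
          [apply DP1; lia | intros; apply is_derive_unique, DP].
      * apply (abs_le_of_derive (fun x => E 0%nat x - P x) (fun x => E 1%nat x - P1 x));
          auto.
        -- intros x; apply (continuous_minus (V := R_NormedModule)); [apply CE; lia|].
           apply (is_poly_continuous _ _ _ HP).
        -- intros x Hx; apply (is_derive_minus (V := R_NormedModule)); [|apply DP].
           apply DE; [lia | exact Hx].
        -- rewrite EP; ring.
Qed.

(** * Whitney's theorem *)

(** The Steklov mean. Its derivative is a difference quotient, which is how bounds on k-th
    differences become bounds on k-th derivatives. *)
Definition avg (h : R) (phi : R -> R) (x : R) : R := RInt phi x (x + h) / h.
Definition avgn (n : nat) (h : R) (phi : R -> R) : R -> R := Nat.iter n (avg h) phi.
Definition dq (h : R) (phi : R -> R) (x : R) : R := (phi (x + h) - phi x) / h.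
Definition dqn (n : nat) (h : R) (phi : R -> R) : R -> R := Nat.iter n (dq h) phi.
Definition cont (phi : R -> R) : Prop := forall x : R, continuous phi x.

Lemma cont_ex_RInt phi a b : cont phi -> ex_RInt phi a b.
Proof. intros H; apply (ex_RInt_continuous (V := R_CompleteNormedModule)); intros; apply H. Qed.

Lemma cont_plus f g : cont f -> cont g -> cont (fun x => f x + g x).
Proof. intros Hf Hg x; apply (continuous_plus (V := R_NormedModule)); auto. Qed.

Lemma cont_scal a f : cont f -> cont (fun x => a * f x).
Proof. intros Hf x; apply (continuous_scal_r (V := R_NormedModule) a f), Hf. Qed.

Lemma cont_comp_affine a b f : cont f -> cont (fun x => f (a + b * x)).
Proof.
  intros Hf x; apply (continuous_comp (fun x => a + b * x) f); [|apply Hf].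
  apply (ex_derive_continuous (K := R_AbsRing) (V := R_NormedModule)); auto_derive; easy.
Qed.

Lemma cont_ext f g : (forall x, f x = g x) -> cont f -> cont g.
Proof. intros H Hf x; apply (continuous_ext f), Hf; exact H. Qed.

Lemma cont_sum (F : nat -> R -> R) n :
  (forall i, cont (F i)) -> cont (fun x => sum_f_R0 (fun i => F i x) n).
Proof.
  intros H; induction n as [|n IH]; simpl; [apply H | apply cont_plus; [exact IH | apply H]].
Qed.

Lemma is_derive_avg h phi (x : R) : cont phi -> is_derive (avg h phi) x (dq h phi x).
Proof.
  intros Hc.
  apply is_derive_ext_R with (fun u => (RInt phi 0 (u + h) - RInt phi 0 u) * / h).
  { intros u; unfold avg, Rdiv; f_equal.
    rewrite <- (RInt_Chasles phi 0 u (u + h)) by (now apply cont_ex_RInt).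
    unfold plus; simpl; ring. }
  assert (D : forall y : R, is_derive (RInt phi 0) y (phi y)).
  { intros y; apply (is_derive_RInt phi (RInt phi 0) 0); [|apply Hc].
    apply filter_forall; intros u.
    apply (RInt_correct (V := R_CompleteNormedModule)), cont_ex_RInt, Hc. }
  revert D; generalize (RInt phi 0); intros I D; unfold dq, Rdiv.
  auto_derive.
  - repeat split; [exists (phi (x + h)) | exists (phi x)]; apply D.
  - replace (Derive (fun y : R => I y) (x + h)) with (phi (x + h))
      by (symmetry; apply is_derive_unique, D).
    replace (Derive (fun y : R => I y) x) with (phi x)
      by (symmetry; apply is_derive_unique, D).
    ring.
Qed.

Lemma cont_avg h phi : cont phi -> cont (avg h phi).
Proof.
  intros Hc x; apply (ex_derive_continuous (K := R_AbsRing) (V := R_NormedModule)).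
  exists (dq h phi x); now apply is_derive_avg.
Qed.

Lemma cont_avgn n h phi : cont phi -> cont (avgn n h phi).
Proof. intros Hc; induction n as [|n IH]; [exact Hc | now apply cont_avg]. Qed.

Lemma cont_dqn n h phi : cont phi -> cont (dqn n h phi).
Proof.
  intros Hc; induction n as [|n IH]; [exact Hc|].
  apply cont_ext with
    (fun x => / h * (dqn n h phi (h + 1 * x)) + (- / h) * dqn n h phi x).
  - intros x; simpl; unfold dq, Rdiv; fold (dqn n h phi).
    replace (h + 1 * x) with (x + h) by ring; ring.
  - apply cont_plus; apply cont_scal; [apply cont_comp_affine|]; exact IH.
Qed.

Lemma RInt_shift (phi : R -> R) a b h : cont phi ->
  RInt (fun u => phi (u + h)) a b = RInt phi (a + h) (b + h).
Proof.
  intros Hc.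
  replace (a + h) with (1 * a + h) by ring; replace (b + h) with (1 * b + h) by ring.
  rewrite <- (RInt_comp_lin (V := R_CompleteNormedModule) phi 1 h a b)
    by (now apply cont_ex_RInt).
  apply RInt_ext; intros; unfold scal; simpl; unfold mult; simpl.
  rewrite !Rmult_1_l; reflexivity.
Qed.

Lemma avg_dq h phi x : cont phi -> avg h (dq h phi) x = dq h (avg h phi) x.
Proof.
  intros Hc; unfold avg, dq, Rdiv.
  rewrite (RInt_ext _ (fun u => minus (scal (/ h) (phi (u + h))) (scal (/ h) (phi u)))).
  2:{ intros; unfold minus, plus, opp, scal; simpl; unfold mult; simpl; ring. }
  assert (Hc' : cont (fun u => phi (u + h))).
  { apply cont_ext with (fun u => phi (h + 1 * u)); [intros; f_equal; ring|].
    now apply cont_comp_affine. }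
  rewrite (RInt_minus (V := R_CompleteNormedModule));
    [|apply (cont_ex_RInt (fun u => / h * phi (u + h))), cont_scal, Hc'
     |apply (cont_ex_RInt (fun u => / h * phi u)), cont_scal, Hc].
  rewrite !(RInt_scal (V := R_CompleteNormedModule)) by (now apply cont_ex_RInt).
  rewrite RInt_shift by assumption.
  unfold minus, plus, opp, scal; simpl; unfold mult; simpl; ring.
Qed.

Lemma avgn_dq n h phi : cont phi -> avgn n h (dq h phi) = dq h (avgn n h phi).
Proof.
  intros Hc; induction n as [|n IH]; [reflexivity|].
  simpl; rewrite IH; apply functional_extensionality; intros x.
  now apply avg_dq, cont_avgn.
Qed.

Lemma is_derive_avgn n h phi x : cont phi ->
  is_derive (avgn (S n) h phi) x (avgn n h (dq h phi) x).
Proof. intros Hc; rewrite avgn_dq by assumption; now apply is_derive_avg, cont_avgn. Qed.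

Lemma avg_bound h phi a b W : 0 < h -> cont phi ->
  (forall x, a <= x <= b + h -> Rabs (phi x) <= W) ->
  forall x, a <= x <= b -> Rabs (avg h phi x) <= W.
Proof.
  intros Hh Hc HW x Hx; unfold avg, Rdiv.
  rewrite Rabs_mult, (Rabs_pos_eq (/ h)) by (left; now apply Rinv_0_lt_compat).
  apply Rmult_le_reg_r with h; [exact Hh|].
  rewrite Rmult_assoc, Rinv_l, Rmult_1_r by lra.
  rewrite Rmult_comm; replace h with ((x + h) - x) at 2 by ring.
  apply abs_RInt_le_const; [lra | now apply cont_ex_RInt | intros; apply HW; lra].
Qed.

Lemma avgn_bound n h phi a b W : 0 < h -> cont phi ->
  (forall x, a <= x <= b + INR n * h -> Rabs (phi x) <= W) ->
  forall x, a <= x <= b -> Rabs (avgn n h phi x) <= W.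
Proof.
  intros Hh Hc; revert b; induction n as [|n IH]; intros b HW x Hx.
  - apply HW; simpl; lra.
  - apply (avg_bound h (avgn n h phi) a b); auto; [now apply cont_avgn|].
    apply IH; intros; apply HW; rewrite S_INR; lra.
Qed.

Lemma avg_plus h f g x : cont f -> cont g ->
  avg h (fun u => f u + g u) x = avg h f x + avg h g x.
Proof.
  intros Hf Hg; unfold avg.
  rewrite (RInt_plus (V := R_CompleteNormedModule) f g) by (now apply cont_ex_RInt).
  unfold plus; simpl; unfold Rdiv; ring.
Qed.

Lemma avg_scal h a f x : cont f -> avg h (fun u => a * f u) x = a * avg h f x.
Proof.
  intros Hf; unfold avg.
  rewrite (RInt_scal (V := R_CompleteNormedModule) f) by (now apply cont_ex_RInt).
  unfold scal; simpl; unfold mult; simpl; unfold Rdiv; ring.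
Qed.

Lemma avgn_plus n h f g : cont f -> cont g ->
  avgn n h (fun u => f u + g u) = fun x => avgn n h f x + avgn n h g x.
Proof.
  intros Hf Hg; induction n as [|n IH]; [reflexivity|].
  simpl; rewrite IH; apply functional_extensionality; intros x.
  now apply avg_plus; apply cont_avgn.
Qed.

Lemma avgn_scal n h a f : cont f -> avgn n h (fun u => a * f u) = fun x => a * avgn n h f x.
Proof.
  intros Hf; induction n as [|n IH]; [reflexivity|].
  simpl; rewrite IH; apply functional_extensionality; intros x.
  now apply avg_scal, cont_avgn.
Qed.

Lemma avgn_sum n h (F : nat -> R -> R) N x : (forall i, cont (F i)) ->
  avgn n h (fun u => sum_f_R0 (fun i => F i u) N) x = sum_f_R0 (fun i => avgn n h (F i) x) N.
Proof.
  intros HF; induction N as [|N IH]; [reflexivity|].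
  simpl; rewrite <- IH, avgn_plus; [reflexivity | now apply cont_sum | apply HF].
Qed.

Lemma avgn_const n h a x : h <> 0 -> avgn n h (fun _ => a) x = a.
Proof.
  intros Hh; revert x; induction n as [|n IH]; intros x; [reflexivity|].
  simpl; unfold avg; rewrite (RInt_ext _ (fun _ => a)) by (intros; apply IH).
  rewrite RInt_const; unfold scal; simpl; unfold mult; simpl; field; exact Hh.
Qed.

(** Averaging over the step of a difference is, term by term, averaging over the argument with the
    width multiplied by [j]. Thus the mean of a k-th difference over its step is a combination of
    iterated Steklov means. *)
Lemma avgn_comp_affine n h (phi : R -> R) x j s : cont phi -> j <> 0 ->
  avgn n h (fun u => phi (x + j * u)) s = avgn n (j * h) phi (x + j * s).
Proof.
  intros Hc Hj; revert s; induction n as [|n IH]; intros s; [reflexivity|].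
  simpl; unfold avg.
  rewrite (RInt_ext _ (fun u => scal (/ j) (j * avgn n (j * h) phi (j * u + x)))).
  2:{ intros u _; change (Nat.iter n (avg h)) with (avgn n h); rewrite IH.
      unfold scal; simpl; unfold mult; simpl.
      replace (x + j * u) with (j * u + x) by ring; field; exact Hj. }
  assert (Hc' := cont_avgn n (j * h) phi Hc).
  rewrite (RInt_scal (V := R_CompleteNormedModule)).
  - assert (E : RInt (fun y => j * avgn n (j * h) phi (j * y + x)) s (s + h) =
      RInt (avgn n (j * h) phi) (j * s + x) (j * (s + h) + x)).
    { apply (RInt_comp_lin (V := R_CompleteNormedModule)); now apply cont_ex_RInt. }
    rewrite E.
    replace (j * s + x) with (x + j * s) by ring.
    replace (j * (s + h) + x) with (x + j * s + j * h) by ring.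
    unfold scal; simpl; unfold mult; simpl; unfold Rdiv; rewrite Rinv_mult; ring.
  - apply cont_ex_RInt.
    apply cont_scal.
    apply cont_ext with (fun u => avgn n (j * h) phi (x + j * u)); [intros; f_equal; ring|].
    now apply cont_comp_affine.
Qed.

Lemma fdiff_S k h g x : fdiff (S k) h g x = fdiff k h g (x + h) - fdiff k h g x.
Proof.
  unfold fdiff.
  set (a := fun l => (-1) ^ (k - l) * Binomial.C k l).
  rewrite (sum_eq (fun l => (-1) ^ (k - l) * Binomial.C k l * g (x + h + INR l * h))
    (fun l => a l * g (x + INR (S l) * h))).
  2:{ intros l _; unfold a; rewrite S_INR; do 2 f_equal; ring. }
  rewrite (sum_eq (fun l => (-1) ^ (k - l) * Binomial.C k l * g (x + INR l * h))
    (fun l => a l * g (x + INR l * h))) by reflexivity.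
  assert (Hkk : forall n, Binomial.C n n = 1).
  { intros n; unfold Binomial.C; rewrite Nat.sub_diag; simpl (fact 0).
    change (INR 1) with 1; field; apply INR_fact_neq_0. }
  assert (Hk0 : forall n, Binomial.C n 0 = 1).
  { intros n; unfold Binomial.C; rewrite Nat.sub_0_r; simpl (fact 0).
    change (INR 1) with 1; field; apply INR_fact_neq_0. }
  destruct k as [|k].
  - simpl; unfold a; simpl; rewrite !Hk0, Hkk; ring.
  - rewrite decomp_sum by lia; simpl Nat.pred.
    rewrite (decomp_sum (fun l => a l * g (x + INR l * h))) by lia; simpl Nat.pred.
    rewrite tech5, (tech5 (fun l => a l * g (x + INR (S l) * h))).
    rewrite (sum_eq (fun l => (-1) ^ (S (S k) - S l) * Binomial.C (S (S k)) (S l)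
        * g (x + INR (S l) * h))
      (fun l => a l * g (x + INR (S l) * h) - a (S l) * g (x + INR (S l) * h))).
    + rewrite minus_sum; unfold a.
      rewrite !Hkk, !Hk0, !Nat.sub_diag, !Nat.sub_0_r.
      simpl pow; ring.
    + intros l Hl; rewrite <- pascal by lia; unfold a.
      replace (S (S k) - S l)%nat with (S (k - l)) by lia.
      replace (S k - l)%nat with (S (k - l)) by lia.
      replace (S k - S l)%nat with (k - l)%nat by lia.
      simpl pow; ring.
Qed.

Lemma dqn_fdiff k h g x : h <> 0 -> dqn k h g x = fdiff k h g x / h ^ k.
Proof.
  intros Hh; revert x; induction k as [|k IH]; intros x.
  - simpl; unfold fdiff; simpl.
    unfold Binomial.C; simpl. replace (x + 0 * h) with x by ring; field.
  - change (dqn (S k) h g x) with (dq h (dqn k h g) x); unfold dq.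
    rewrite !IH, fdiff_S; simpl; field; split; [now apply pow_nonzero | exact Hh].
Qed.

Lemma fdiff_step0 k g x : (1 <= k)%nat -> fdiff k 0 g x = 0.
Proof. intros Hk; destruct k as [|k]; [lia|]; rewrite fdiff_S, Rplus_0_r; ring. Qed.

Lemma is_derive_sum (F G : nat -> R -> R) n x : (forall i, is_derive (F i) x (G i x)) ->
  is_derive (fun u => sum_f_R0 (fun i => F i u) n) x (sum_f_R0 (fun i => G i x) n).
Proof.
  intros H; induction n as [|n IH]; [apply H|].
  simpl; apply (is_derive_plus (V := R_NormedModule)); [exact IH | apply H].
Qed.

(** Forward differences and averages need room on the right of the point, so the estimate stops at
    3/4; [whitney] recovers the rest by reflection. *)
Lemma whitney_left k : (1 <= k)%nat -> exists C, 0 <= C /\ forall g W, cont g -> 0 <= W ->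
  (forall h x, 0 < h -> 0 <= x -> x + INR k * h <= 1 -> Rabs (fdiff k h g x) <= W) ->
  exists Q, is_poly k Q /\ forall x, 0 <= x <= 3 / 4 -> Rabs (g x - Q x) <= C * W.
Proof.
  intros Hk.
  (* A step of the averaged difference is a sum of k variables of size at most [d], and k such steps
     are taken: the total length k * k * d is 1/4, the room beyond 3/4. *)
  set (d := / (4 * INR k * INR k)).
  assert (HK : 1 <= INR k) by (apply (le_INR 1); exact Hk).
  assert (Hd : 0 < d) by (apply Rinv_0_lt_compat; nra).
  assert (HKd : INR k * (INR k * d) = / 4) by (unfold d; field; lra).
  set (b := fun j => (-1) ^ (k - j) * Binomial.C k j).
  set (CT := sum_f_R0 (fun l => Rabs (b (S l)) / (INR (S l) * d) ^ k) (Nat.pred k)).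
  assert (Hj : forall l, 0 < INR (S l) * d)
    by (intros l; apply Rmult_lt_0_compat; [apply lt_0_INR; lia | exact Hd]).
  assert (HCT : 0 <= CT).
  { apply cond_pos_sum; intros l; apply Rmult_le_pos; [apply Rabs_pos|].
    left; apply Rinv_0_lt_compat, pow_lt, Hj. }
  exists (1 + CT); split; [lra|].
  intros g W Hg HW HF.
  (* The smoothed function [T 0] differs from [g] by an average of k-th differences, and its
     k-th derivative [T k] is a combination of k-th difference quotients. *)
  set (T := fun i x => - (-1) ^ k *
    sum_f_R0 (fun l => b (S l) *
      avgn (k - i) (INR (S l) * d) (dqn i (INR (S l) * d) g) x) (Nat.pred k)).
  (* The k-th derivative of [T 0] is small, so it is approximated by zero, and the result is a
     polynomial of order k close to [T 0]. *)
  destruct (taylor_poly k 0 T 0 (3 / 4) 0 (fun _ => 0) (CT * W)) as [P [HP [_ BP]]].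
  - lra.
  - intros i x _; unfold T; apply cont_scal.
    apply (cont_sum (fun l x => b (S l) *
      avgn (k - i) (INR (S l) * d) (dqn i (INR (S l) * d) g) x)).
    intros l; now apply cont_scal, cont_avgn, cont_dqn.
  - intros i x Hi _; unfold T.
    apply (is_derive_scal (fun x => sum_f_R0 (fun l => b (S l) *
      avgn (k - i) (INR (S l) * d) (dqn i (INR (S l) * d) g) x) (Nat.pred k))).
    apply (is_derive_sum (fun l x => b (S l) *
      avgn (k - i) (INR (S l) * d) (dqn i (INR (S l) * d) g) x)
      (fun l x => b (S l) *
      avgn (k - S i) (INR (S l) * d) (dqn (S i) (INR (S l) * d) g) x)).
    intros l; apply (is_derive_scal (avgn (k - i) (INR (S l) * d)
      (dqn i (INR (S l) * d) g))).
    replace (k - i)%nat with (S (k - S i)) by lia.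
    now apply is_derive_avgn, cont_dqn.
  - apply is_poly_zero.
  - now apply Rmult_le_pos.
  - intros x Hx; unfold T; rewrite Rminus_0_r, Nat.sub_diag.
    rewrite Rabs_mult, Rabs_Ropp, pow_1_abs, Rmult_1_l.
    apply Rle_trans with (1 := Rsum_abs _ _).
    unfold CT; rewrite Rmult_comm, scal_sum.
    apply sum_Rle; intros l Hl.
    change (avgn 0 (INR (S l) * d) (dqn k (INR (S l) * d) g) x)
      with (dqn k (INR (S l) * d) g x).
    rewrite Rabs_mult, dqn_fdiff by (apply Rgt_not_eq, Hj).
    unfold Rdiv; rewrite Rabs_mult, (Rabs_pos_eq (/ _))
      by (left; apply Rinv_0_lt_compat, pow_lt, Hj).
    rewrite Rmult_assoc; apply Rmult_le_compat_l; [apply Rabs_pos|].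
    rewrite Rmult_comm; apply Rmult_le_compat_l;
      [left; apply Rinv_0_lt_compat, pow_lt, Hj|].
    apply HF; [apply Hj | lra |].
    assert (INR (S l) <= INR k) by (apply le_INR; lia).
    assert (INR k * (INR (S l) * d) <= INR k * (INR k * d)).
    { apply Rmult_le_compat_l; [lra|]; apply Rmult_le_compat_r; lra. }
    lra.
  - exists P; split; [exact HP|].
    intros x Hx.
    (* The term l = 0 of the difference does not depend on the step, so its average is (-1)^k [g x];
       the remaining terms average to those of [T 0] up to sign. *)
    assert (E : g x - T 0%nat x = (-1) ^ k * avgn k d (fun s => fdiff k s g x) 0).
    { unfold fdiff.
      rewrite (avgn_sum k d (fun l s => (-1) ^ (k - l) * Binomial.C k l * g (x + INR l * s))).
      2:{ intros l.
          now apply (cont_scal _ (fun s => g (x + INR l * s))), cont_comp_affine. }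
      rewrite decomp_sum by lia.
      rewrite (sum_eq _ (fun l => b (S l) * avgn k (INR (S l) * d) g x)).
      2:{ intros l _.
          rewrite (avgn_scal k d _ (fun s => g (x + INR (S l) * s)))
            by (now apply cont_comp_affine).
          rewrite avgn_comp_affine, Rmult_0_r, Rplus_0_r;
            [reflexivity | exact Hg | apply not_0_INR; lia]. }
      rewrite (avgn_scal k d _ (fun s => g (x + INR 0 * s))) by (now apply cont_comp_affine).
      replace (fun s : R => g (x + INR 0 * s)) with (fun _ : R => g x)
        by (apply functional_extensionality; intros s; f_equal; simpl; ring).
      rewrite avgn_const by lra.
      unfold T; rewrite !Nat.sub_0_r.
      assert (H0 : Binomial.C k 0 = 1).
      { unfold Binomial.C; rewrite Nat.sub_0_r; simpl (fact 0).
        change (INR 1) with 1; field; apply INR_fact_neq_0. }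
      rewrite H0.
      assert (H1 : (-1) ^ k * (-1) ^ k = 1)
        by (rewrite <- Rpow_mult_distr; replace (-1 * -1) with 1 by ring; apply pow1).
      change (sum_f_R0 (fun l => b (S l) * avgn k (INR (S l) * d) (dqn 0 (INR (S l) * d) g) x)
        (Nat.pred k)) with (sum_f_R0 (fun l => b (S l) * avgn k (INR (S l) * d) g x)
        (Nat.pred k)).
      set (s := sum_f_R0 _ _).
      transitivity (((-1) ^ k * (-1) ^ k) * g x + (-1) ^ k * s); [rewrite H1; ring | ring]. }
    replace (g x - P x) with ((g x - T 0%nat x) + (T 0%nat x - P x)) by ring.
    apply Rle_trans with (1 := Rabs_triang _ _).
    assert (B1 : Rabs (g x - T 0%nat x) <= W).
    { rewrite E, Rabs_mult, pow_1_abs, Rmult_1_l.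
      apply (avgn_bound k d _ 0 0); [exact Hd | | | lra].
      - unfold fdiff.
        apply (cont_sum (fun l s => (-1) ^ (k - l) * Binomial.C k l * g (x + INR l * s))).
        intros l; now apply (cont_scal _ (fun s => g (x + INR l * s))), cont_comp_affine.
      - intros s Hs; destruct (Rle_lt_or_eq_dec 0 s) as [H|H]; [lra | |].
        + apply HF; [exact H | lra |].
          assert (INR k * s <= INR k * (INR k * d)) by (apply Rmult_le_compat_l; lra).
          lra.
        + rewrite <- H, fdiff_step0, Rabs_R0 by exact Hk; exact HW. }
    assert (B2 := BP x Hx).
    assert (Rabs (x - 0) ^ k <= 1).
    { rewrite <- (pow1 k); apply pow_incr; split; [apply Rabs_pos|].
      rewrite Rabs_pos_eq; lra. }
    assert (CT * W * Rabs (x - 0) ^ k <= CT * W * 1)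
      by (apply Rmult_le_compat_l; [now apply Rmult_le_pos | assumption]).
    lra.
Qed.

Lemma sum_f_R0_rev (F : nat -> R) n : sum_f_R0 F n = sum_f_R0 (fun l => F (n - l)%nat) n.
Proof.
  revert F; induction n as [|n IH]; intros F; [reflexivity|].
  rewrite (decomp_sum (fun l => F (S n - l)%nat)) by lia.
  rewrite tech5, IH, Rplus_comm; reflexivity.
Qed.

Lemma fdiff_reflect k h g x :
  fdiff k h (fun u => g (1 - u)) x = (-1) ^ k * fdiff k h g (1 - x - INR k * h).
Proof.
  unfold fdiff; rewrite sum_f_R0_rev, scal_sum.
  apply sum_eq; intros l Hl.
  rewrite <- pascal_step1 by exact Hl.
  rewrite minus_INR by exact Hl.
  replace (k - (k - l))%nat with l by lia.
  replace (1 - (x + (INR k - INR l) * h)) with (1 - x - INR k * h + INR l * h) by ring.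
  assert (E : (-1) ^ k = (-1) ^ (k - l) * (-1) ^ l) by (rewrite <- pow_add; f_equal; lia).
  assert (H1 : (-1) ^ (k - l) * (-1) ^ (k - l) = 1)
    by (rewrite <- Rpow_mult_distr; replace (-1 * -1) with 1 by ring; apply pow1).
  rewrite E.
  transitivity (((-1) ^ (k - l) * (-1) ^ (k - l)) * ((-1) ^ l * Binomial.C k l *
    g (1 - x - INR k * h + INR l * h))); [rewrite H1; ring | ring].
Qed.

(** After rescaling to [0, 1], [whitney_left] and its mirror image give polynomials for [0, 3/4] and
    [1/4, 1]. They are close on the overlap, hence by [poly_growth] on all of [0, 1], so the first
    one serves everywhere. *)
Theorem whitney k : (1 <= k)%nat -> exists C, 0 <= C /\ forall g a b W, cont g -> a < b -> 0 <= W ->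
  (forall h x, 0 < h -> a <= x -> x + INR k * h <= b -> Rabs (fdiff k h g x) <= W) ->
  exists Q, is_poly k Q /\ forall x, a <= x <= b -> Rabs (g x - Q x) <= C * W.
Proof.
  intros Hk; destruct (whitney_left k Hk) as [C [HC HL]].
  destruct (poly_growth k 2) as [C' [HC' HG]]; [lra|].
  exists (C + C' * (2 * C)); split; [nra|].
  intros g0 a b W Hg0 Hab HW HF0.
  set (g := fun x => g0 (a + (b - a) * x)).
  assert (Hg : cont g) by (now apply cont_comp_affine).
  assert (HF : forall h x, 0 < h -> 0 <= x -> x + INR k * h <= 1 -> Rabs (fdiff k h g x) <= W).
  { intros h x Hh Hx Hxh.
    replace (fdiff k h g x) with (fdiff k ((b - a) * h) g0 (a + (b - a) * x)).
    - apply HF0; [nra | nra |].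
      replace (a + (b - a) * x + INR k * ((b - a) * h))
        with (a + (b - a) * (x + INR k * h)) by ring.
      nra.
    - unfold fdiff, g; apply sum_eq; intros l _; do 2 f_equal; ring. }
  destruct (HL g W Hg HW HF) as [P [HP BP]].
  destruct (HL (fun u => g (1 - u)) W) as [P' [HP' BP']]; auto.
  { apply cont_ext with (fun u => g (1 + (-1) * u)); [intros; f_equal; ring|].
    now apply cont_comp_affine. }
  { intros h x Hh Hx Hxh; rewrite fdiff_reflect, Rabs_mult, pow_1_abs, Rmult_1_l.
    apply HF; lra. }
  assert (HQ : is_poly k (fun x => P' (1 - x))).
  { apply is_poly_ext with (fun x => P' (1 + (-1) * x)); [intros; f_equal; ring|].
    now apply is_poly_comp_affine. }
  assert (BQ : forall x, 1 / 4 <= x <= 1 -> Rabs (g x - P' (1 - x)) <= C * W).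
  { intros x Hx; specialize (BP' (1 - x)); replace (1 - (1 - x)) with x in BP' by ring.
    apply BP'; lra. }
  assert (BD : forall x, 0 <= x <= 1 -> Rabs (P' (1 - x) - P x) <= C' * (2 * (C * W))).
  { intros x Hx.
    apply (HG (fun x => P' (1 - x) - P x) (1 / 4) (1 / 2)); [lra | now apply is_poly_minus | |].
    - intros u Hu; replace (P' (1 - u) - P u) with ((g u - P u) - (g u - P' (1 - u))) by ring.
      apply Rle_trans with (1 := Rabs_triang _ _); rewrite Rabs_Ropp.
      specialize (BP u ltac:(lra)); specialize (BQ u ltac:(lra)); lra.
    - apply Rabs_le; lra. }
  assert (HCW : 0 <= C * W) by nra.
  assert (HCW' : 0 <= C' * (2 * (C * W))) by (apply Rmult_le_pos; lra).
  assert (B : forall x, 0 <= x <= 1 -> Rabs (g x - P x) <= (C + C' * (2 * C)) * W).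
  { intros x Hx; replace ((C + C' * (2 * C)) * W) with (C * W + C' * (2 * (C * W))) by ring.
    destruct (Rle_dec x (3 / 4)).
    - specialize (BP x ltac:(lra)); lra.
    - replace (g x - P x) with ((g x - P' (1 - x)) + (P' (1 - x) - P x)) by ring.
      apply Rle_trans with (1 := Rabs_triang _ _).
      specialize (BQ x ltac:(lra)); specialize (BD x Hx); lra. }
  exists (fun x => P ((- a / (b - a)) + / (b - a) * x)); split;
    [now apply is_poly_comp_affine|].
  intros x Hx; set (u := - a / (b - a) + / (b - a) * x).
  assert (Eu : a + (b - a) * u = x) by (unfold u; field; lra).
  rewrite <- Eu at 1; apply (B u).
  split; nra.
Qed.

(** * De Boor's algorithm *)

(* De Boor's algorithm: [db t e c e i] is the polynomial piece, between the knots [t i] and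
   [t (i + 1)], of the spline of degree [e] with B-spline coefficients [c]. *)
Fixpoint db (t : Z -> R) (e : nat) (c : Z -> R) (l : nat) (j : Z) (x : R) : R :=
  match l with
  | O => c j
  | S l' =>
    ((x - t j) * db t e c l' j x + (t (j + Z.of_nat (e - l'))%Z - x) * db t e c l' (j - 1)%Z x)
    / (t (j + Z.of_nat (e - l'))%Z - t j)
  end.

Lemma db_S t e c l j x : db t e c (S l) j x =
  ((x - t j) * db t e c l j x + (t (j + Z.of_nat (e - l))%Z - x) * db t e c l (j - 1)%Z x)
  / (t (j + Z.of_nat (e - l))%Z - t j).
Proof. reflexivity. Qed.

Lemma db_is_poly t e c l j : is_poly (S l) (db t e c l j).
Proof.
  revert j; induction l as [|l IH]; intros j; simpl; [apply is_poly_const|].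
  set (T := t (j + Z.of_nat (e - l))%Z).
  apply is_poly_ext with (fun x => / (T - t j) * ((- t j + 1 * x) * db t e c l j x
    + (T + (-1) * x) * db t e c l (j - 1)%Z x)).
  - intros x; unfold Rdiv; ring.
  - apply is_poly_scal, is_poly_plus; apply is_poly_mul_affine, IH.
Qed.

Lemma db_lin t e c c' a b l j x :
  db t e (fun j => a * c j + b * c' j) l j x = a * db t e c l j x + b * db t e c' l j x.
Proof.
  revert j; induction l as [|l IH]; intros j; simpl; [reflexivity|].
  rewrite !IH; unfold Rdiv; ring.
Qed.

Lemma db_ext t e c c' l j x :
  (forall j', (j - Z.of_nat l <= j' <= j)%Z -> c j' = c' j') ->
  db t e c l j x = db t e c' l j x.
Proof.
  revert j; induction l as [|l IH]; intros j H; simpl; [apply H; lia|].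
  rewrite (IH j), (IH (j - 1)%Z); [reflexivity | |]; intros; apply H; lia.
Qed.

Definition antitone (t : Z -> R) : Prop := forall a b : Z, (a <= b)%Z -> t b <= t a.

(** For the entries that feed the i-th piece, [x] lies between [t (j + e - l)] and [t j], so every
    step of the algorithm is a convex combination. Its denominators are negative because the knots
    decrease. *)
Lemma db_nonneg t e c i x : antitone t -> t (i + 1)%Z < t i -> t (i + 1)%Z <= x <= t i ->
  (forall j, (i - Z.of_nat e <= j <= i)%Z -> 0 <= c j) ->
  forall l j, (l <= e)%nat -> (i - Z.of_nat (e - l) <= j <= i)%Z -> 0 <= db t e c l j x.
Proof.
  intros Ht Hi Hx Hc; induction l as [|l IH]; intros j Hl Hj; simpl.
  - apply Hc; lia.
  - assert (H1 := IH j ltac:(lia) ltac:(lia)).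
    assert (H2 := IH (j - 1)%Z ltac:(lia) ltac:(lia)).
    assert (T1 : t i <= t j) by (apply Ht; lia).
    assert (T2 : t (j + Z.of_nat (e - l))%Z <= t (i + 1)%Z) by (apply Ht; lia).
    set (T := t (j + _)%Z) in *.
    replace (((x - t j) * db t e c l j x + (T - x) * db t e c l (j - 1) x) / (T - t j))
      with (((t j - x) * db t e c l j x + (x - T) * db t e c l (j - 1) x) / (t j - T))
      by (field; lra).
    apply Rmult_le_pos; [|left; apply Rinv_0_lt_compat; lra].
    apply Rplus_le_le_0_compat; apply Rmult_le_pos; lra.
Qed.

Lemma db_const t e M i x : antitone t -> t (i + 1)%Z < t i ->
  forall l j, (l <= e)%nat -> (i - Z.of_nat (e - l) <= j <= i)%Z ->
  db t e (fun _ => M) l j x = M.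
Proof.
  intros Ht Hi; induction l as [|l IH]; intros j Hl Hj; simpl; [reflexivity|].
  rewrite !IH by lia.
  assert (T1 : t i <= t j) by (apply Ht; lia).
  assert (T2 : t (j + Z.of_nat (e - l))%Z <= t (i + 1)%Z) by (apply Ht; lia).
  field; lra.
Qed.

Lemma db_ge t e c M i x : antitone t -> t (i + 1)%Z < t i -> t (i + 1)%Z <= x <= t i ->
  (forall j, (i - Z.of_nat e <= j <= i)%Z -> M <= c j) -> M <= db t e c e i x.
Proof.
  intros Ht Hi Hx Hc.
  assert (H : 0 <= db t e (fun j => 1 * c j + (-1) * M) e i x).
  { apply (db_nonneg t e _ i x); auto; try lia.
    intros j Hj; specialize (Hc j Hj); lra. }
  rewrite db_lin, (db_const t e M i x Ht Hi) in H by lia; lra.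
Qed.

Lemma db_abs_le t e c M i x : antitone t -> t (i + 1)%Z < t i -> t (i + 1)%Z <= x <= t i ->
  (forall j, (i - Z.of_nat e <= j <= i)%Z -> Rabs (c j) <= M) -> Rabs (db t e c e i x) <= M.
Proof.
  intros Ht Hi Hx Hc; apply Rabs_le; split.
  - apply db_ge; auto; intros j Hj.
    apply (proj1 (Rabs_le_between _ _) (Hc j Hj)).
  - assert (H : - M <= db t e (fun j => (-1) * c j + 0 * c j) e i x).
    { apply db_ge; auto; intros j Hj.
      assert (B := proj1 (Rabs_le_between _ _) (Hc j Hj)); lra. }
    rewrite db_lin in H; lra.
Qed.

(* Discrete differentiation: differences of the columns of the algorithm form the columns of
   the algorithm of degree one less. *)
Lemma db_difference t e c i :
  (forall a b, (a <= i <= b)%Z -> (a < b)%Z -> t a <> t b) ->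
  forall l j x, (l <= e)%nat -> (i - Z.of_nat (S e - l) <= j <= i)%Z ->
  db t (S e) c l j x - db t (S e) c l (j - 1)%Z x =
  (t (j + Z.of_nat (S e - l))%Z - t j) *
  db t e (fun j => (c j - c (j - 1)%Z) / (t (j + Z.of_nat (S e))%Z - t j)) l j x.
Proof.
  intros Ht; induction l as [|l IH]; intros j x Hl Hj.
  - simpl; field.
    apply Rminus_eq_contra, not_eq_sym, Ht; lia.
  - set (c' := fun j => _) in *.
    assert (E1 := IH j x ltac:(lia) ltac:(lia)).
    assert (E2 := IH (j - 1)%Z x ltac:(lia) ltac:(lia)).
    rewrite !db_S.
    replace (S e - l)%nat with (S (e - l)) in * by lia.
    replace (S e - S l)%nat with (e - l)%nat by lia.
    replace (j - 1 + Z.of_nat (S (e - l)))%Z with (j + Z.of_nat (e - l))%Z in * by lia.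
    assert (N1 : t (j + Z.of_nat (S (e - l)))%Z - t j <> 0)
      by (apply Rminus_eq_contra, not_eq_sym, Ht; lia).
    assert (N2 : t (j + Z.of_nat (e - l))%Z - t (j - 1)%Z <> 0)
      by (apply Rminus_eq_contra, not_eq_sym, Ht; lia).
    assert (N3 : t (j + Z.of_nat (e - l))%Z - t j <> 0)
      by (apply Rminus_eq_contra, not_eq_sym, Ht; lia).
    revert E1 E2 N1 N2 N3.
    generalize (db t (S e) c l j x) (db t (S e) c l (j - 1)%Z x)
      (db t (S e) c l (j - 1 - 1)%Z x) (db t e c' l j x) (db t e c' l (j - 1)%Z x)
      (t (j + Z.of_nat (S (e - l)))%Z) (t (j + Z.of_nat (e - l))%Z) (t j) (t (j - 1)%Z).
    intros d0 d1 d2 f0 f1 T1 T0 tj tj1 E1 E2 N1 N2 N3.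
    replace d0 with (d1 + (T1 - tj) * f0) by lra.
    replace d2 with (d1 - (T0 - tj1) * f1) by lra.
    field; auto.
Qed.

(** This is the smoothness of the spline at a simple knot. By [db_difference] both adjacent pieces
    of degree e + 1 have the form d + (x - t i) f with the same d, where f is the corresponding
    piece of degree e; so each degree contributes one factor x - t i to the difference. *)
Lemma db_jump t e c i :
  (forall a b, (a <= i <= b)%Z -> (a < b)%Z -> t a <> t b) ->
  exists gamma, forall x,
    db t e c e i x - db t e c e (i - 1)%Z x = gamma * (x - t i) ^ e.
Proof.
  intros Ht; revert c; induction e as [|e IH]; intros c.
  - exists (c i - c (i - 1)%Z); intros x; simpl; ring.
  - set (c' := fun j => (c j - c (j - 1)%Z) / (t (j + Z.of_nat (S e))%Z - t j)).
    destruct (IH c') as [gamma H]; exists gamma; intros x.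
    assert (E1 := db_difference t e c i Ht e i x ltac:(lia) ltac:(lia)).
    assert (E2 := db_difference t e c i Ht e (i - 1)%Z x ltac:(lia) ltac:(lia)).
    fold c' in E1, E2; specialize (H x).
    replace (S e - e)%nat with 1%nat in E1, E2 by lia.
    rewrite !db_S; replace (S e - e)%nat with 1%nat by lia.
    replace (i - 1 + Z.of_nat 1)%Z with i in * by lia.
    assert (N1 : t (i + Z.of_nat 1)%Z - t i <> 0)
      by (apply Rminus_eq_contra, not_eq_sym, Ht; lia).
    assert (N2 : t i - t (i - 1)%Z <> 0)
      by (apply Rminus_eq_contra, not_eq_sym, Ht; lia).
    rewrite <- tech_pow_Rmult.
    revert H E1 E2 N1 N2.
    generalize (db t (S e) c e i x) (db t (S e) c e (i - 1)%Z x)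
      (db t (S e) c e (i - 1 - 1)%Z x) (db t e c' e i x) (db t e c' e (i - 1)%Z x)
      (t (i + Z.of_nat 1)%Z) (t (i - 1)%Z) (t i) ((x - t i) ^ e).
    intros d0 d1 d2 f0 f1 T1 T0 ti p H E1 E2 N1 N2.
    replace d0 with (d1 + (T1 - ti) * f0) by lra.
    replace d2 with (d1 - (ti - T0) * f1) by lra.
    replace (gamma * ((x - ti) * p)) with ((x - ti) * (f0 - f1)) by (rewrite H; ring).
    field; auto.
Qed.

(* Polar derivative: it lowers the degree [n] by one, and iterating it at [u_1, ..., u_n]
   yields the value of the blossom of [q] at these points. *)
Definition polar (n : nat) (u : R) (q : R -> R) (x : R) : R :=
  q x + (u - x) * Derive q x / INR n.

(** The division by [n] is made so that the terms of degree n cancel: x^n - x (n x^(n-1)) / n =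
    0. *)
Lemma polar_is_poly n u q : (1 <= n)%nat -> is_poly (S n) q -> is_poly n (polar n u q).
Proof.
  revert u q; induction n as [|n IH]; intros u q Hn Hq; [lia|].
  destruct (is_poly_S_inv _ _ Hq) as [c [q1 [Hq1 Eq]]].
  assert (HN : INR (S n) <> 0) by (apply not_0_INR; lia).
  assert (D : forall x, Derive q x = q1 x + x * Derive q1 x).
  { intros x; rewrite (Derive_ext q _ x Eq); apply is_derive_unique.
    assert (Dg := is_poly_ex_derive _ q1 x Hq1).
    auto_derive; [exact Dg|].
    change (Derive (fun u : R => q1 u) x) with (Derive q1 x); ring. }
  destruct n as [|n].
  - destruct (is_poly_S_inv _ _ Hq1) as [d [q2 [Hq2 Eq2]]].
    assert (D1 : forall x, Derive q1 x = 0)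
      by (intros x; apply (is_poly_0_inv _ (is_poly_Derive 0 q1 Hq1))).
    apply is_poly_ext with (fun _ => c + u * d); [|apply is_poly_const].
    intros x; unfold polar; rewrite D, D1, Eq, Eq2, (is_poly_0_inv _ Hq2); simpl; field.
  - assert (H := IH u q1 ltac:(lia) Hq1).
    apply is_poly_ext with (fun x => (u / INR (S (S n)) * q1 x) +
      (c + x * (INR (S n) / INR (S (S n)) * polar (S n) u q1 x))).
    + intros x; unfold polar; rewrite D, Eq, !(S_INR (S n)).
      assert (INR (S n) <> 0) by (apply not_0_INR; lia).
      rewrite S_INR in HN.
      field; auto.
    + apply is_poly_plus; [apply is_poly_scal, Hq1|].
      apply is_poly_S_intro, is_poly_scal, H.
Qed.

Lemma Derive_polar n u m q x : is_poly m q ->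
  Derive (polar n u q) x =
  Derive q x - Derive q x / INR n + (u - x) * Derive (Derive q) x / INR n.
Proof.
  intros Hq; apply is_derive_unique; unfold polar.
  assert (D1 := is_poly_ex_derive _ _ x Hq).
  assert (D2 := is_poly_ex_derive _ _ x (is_poly_Derive_weak _ _ Hq)).
  assert (H : forall q' : R -> R, ex_derive q' x ->
    is_derive (fun y => q y + (u - y) * q' y / INR n) x
      (Derive q x - q' x / INR n + (u - x) * Derive q' x / INR n)).
  { intros q' D'; auto_derive; [repeat split; assumption|].
    change (Derive (fun u : R => q u) x) with (Derive q x).
    change (Derive (fun u : R => q' u) x) with (Derive q' x).
    unfold Rdiv; ring. }
  apply H, D2.
Qed.

(** The symmetry of the blossom in its arguments; it lets [blossom_pred] treat the knot [t j], which
    comes first in the list of arguments, as if it came last. *)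
Lemma polar_comm n u v m q : is_poly m q -> (1 <= n)%nat ->
  polar n u (polar (S n) v q) = polar n v (polar (S n) u q).
Proof.
  intros Hq Hn; apply functional_extensionality; intros x; unfold polar at 1 3.
  rewrite !(Derive_polar _ _ m) by exact Hq; unfold polar; rewrite S_INR.
  assert (0 < INR n) by (apply lt_0_INR; lia).
  field; lra.
Qed.

(* [blossom t e q s j] applies the polar derivatives at the knots [t (j+1), ..., t (j+s)];
   for [s = e] it is the constant equal to the j-th B-spline coefficient of [q]. *)
Fixpoint blossom (t : Z -> R) (e : nat) (q : R -> R) (s : nat) (j : Z) : R -> R :=
  match s with
  | O => q
  | S s' => polar (e - s') (t (j + Z.of_nat (S s'))%Z) (blossom t e q s' j)
  end.

Definition coef (t : Z -> R) (e : nat) (q : R -> R) (j : Z) : R := blossom t e q e j 0.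

Lemma blossom_is_poly t e q s j : is_poly (S e) q -> (s <= e)%nat ->
  is_poly (S (e - s)) (blossom t e q s j).
Proof.
  intros Hq; induction s as [|s IH]; intros Hs; [now rewrite Nat.sub_0_r|].
  replace (S (e - S s)) with (e - s)%nat by lia.
  apply polar_is_poly; [lia | apply IH; lia].
Qed.

Lemma blossom_pred t e q s j : is_poly (S e) q -> (s < e)%nat ->
  blossom t e q (S s) (j - 1) = polar (e - s) (t j) (blossom t e q s j).
Proof.
  intros Hq; induction s as [|s IH]; intros Hs.
  - simpl; do 2 f_equal; lia.
  - change (blossom t e q (S (S s)) (j - 1)) with
      (polar (e - S s) (t (j - 1 + Z.of_nat (S (S s)))%Z) (blossom t e q (S s) (j - 1))).
    rewrite IH by lia.
    replace (j - 1 + Z.of_nat (S (S s)))%Z with (j + Z.of_nat (S s))%Z by lia.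
    replace (e - s)%nat with (S (e - S s)) by lia.
    rewrite (polar_comm _ _ _ (S (e - s))); [| apply blossom_is_poly; [exact Hq | lia] | lia].
    replace (S (e - S s)) with (e - s)%nat by lia; reflexivity.
Qed.

(** The two entries combined at a step are polar derivatives of one blossom, at [t (j + e - l)] and
    at [t j]. The polar derivative is affine in its argument [u], and the step interpolates it at u
    = x, where it is the blossom itself. *)
Lemma db_coef t e q i : is_poly (S e) q -> antitone t -> t (i + 1)%Z < t i ->
  forall l j x, (l <= e)%nat -> (i - Z.of_nat (e - l) <= j <= i)%Z ->
  db t e (coef t e q) l j x = blossom t e q (e - l) j x.
Proof.
  intros Hq Ht Hi; induction l as [|l IH]; intros j x Hl Hj.
  - simpl; unfold coef; rewrite Nat.sub_0_r.
    assert (H := blossom_is_poly t e q e j Hq ltac:(lia)).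
    rewrite Nat.sub_diag in H; destruct (is_poly_S_inv _ _ H) as [c [g [Hg E]]].
    rewrite !E, !(is_poly_0_inv _ Hg); ring.
  - rewrite db_S, !IH by lia.
    assert (T1 : t i <= t j) by (apply Ht; lia).
    assert (T2 : t (j + Z.of_nat (e - l))%Z <= t (i + 1)%Z) by (apply Ht; lia).
    replace (e - l)%nat with (S (e - S l)) in * by lia.
    rewrite blossom_pred by (assumption || lia).
    replace (e - (e - S l))%nat with (S l) by lia.
    change (blossom t e q (S (e - S l)) j x) with
      (polar (e - (e - S l)) (t (j + Z.of_nat (S (e - S l)))%Z) (blossom t e q (e - S l) j) x).
    replace (e - (e - S l))%nat with (S l) by lia.
    unfold polar.
    assert (INR (S l) <> 0) by (apply not_0_INR; lia).
    field; split; [exact H | lra].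
Qed.

Lemma db_reproduces t e q i x : is_poly (S e) q -> antitone t -> t (i + 1)%Z < t i ->
  db t e (coef t e q) e i x = q x.
Proof.
  intros Hq Ht Hi; rewrite (db_coef t e q i Hq Ht Hi) by lia.
  rewrite Nat.sub_diag; reflexivity.
Qed.

Lemma coef_lin t e a p b q j : is_poly (S e) p -> is_poly (S e) q ->
  coef t e (fun x => a * p x + b * q x) j = a * coef t e p j + b * coef t e q j.
Proof.
  intros Hp Hq; unfold coef.
  assert (H : forall s, (s <= e)%nat -> blossom t e (fun x => a * p x + b * q x) s j =
    fun x => a * blossom t e p s j x + b * blossom t e q s j x).
  { induction s as [|s IH]; intros Hs; [reflexivity|].
    simpl blossom; rewrite IH by lia; apply functional_extensionality; intros x.
    unfold polar.
    assert (D1 := is_poly_ex_derive _ _ x (blossom_is_poly t e p s j Hp ltac:(lia))).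
    assert (D2 := is_poly_ex_derive _ _ x (blossom_is_poly t e q s j Hq ltac:(lia))).
    rewrite Derive_plus, !Derive_scal by (apply ex_derive_scal; assumption).
    unfold Rdiv; ring. }
  rewrite H by lia; reflexivity.
Qed.

Lemma coef_const t e c j : coef t e (fun _ => c) j = c.
Proof.
  unfold coef.
  assert (H : forall s, blossom t e (fun _ => c) s j = fun _ => c).
  { induction s as [|s IH]; [reflexivity|].
    simpl blossom; rewrite IH; apply functional_extensionality; intros x.
    unfold polar; rewrite Derive_const; unfold Rdiv; ring. }
  now rewrite H.
Qed.

(** Each of the e polar derivatives costs at most a constant factor: the derivative is at most a
    multiple of M / h by [poly_markov], and its argument is at distance at most (K + 1) h. The
    interval of control is any one whose distance to the knots is comparable to its length. *)
Lemma coef_bound e K : 0 <= K -> exists C, 0 <= C /\ forall t q j a h M, 0 < h ->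
  is_poly (S e) q -> (forall x, a <= x <= a + h -> Rabs (q x) <= M) ->
  (forall s, (1 <= s <= e)%nat -> Rabs (t (j + Z.of_nat s)%Z - a) <= K * h) ->
  Rabs (coef t e q j) <= C * M.
Proof.
  intros HK.
  assert (H : forall s, (s <= e)%nat -> exists C, 0 <= C /\ forall t q j a h M, 0 < h ->
    is_poly (S e) q -> (forall x, a <= x <= a + h -> Rabs (q x) <= M) ->
    (forall s, (1 <= s <= e)%nat -> Rabs (t (j + Z.of_nat s)%Z - a) <= K * h) ->
    forall x, a <= x <= a + h -> Rabs (blossom t e q s j x) <= C * M).
  { induction s as [|s IH]; intros Hs.
    - exists 1; split; [lra|]; intros t q j a h M Hh Hq HM HT x Hx.
      rewrite Rmult_1_l; now apply HM.
    - destruct IH as [C [HC IH]]; [lia|].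
      destruct (poly_markov (S (e - s))) as [C' [HC' HMk]].
      exists (C + (K + 1) * (C' * C)); split.
      { apply Rplus_le_le_0_compat; [exact HC|].
        apply Rmult_le_pos; [lra | now apply Rmult_le_pos]. }
      intros t q j a h M Hh Hq HM HT x Hx.
      assert (B := IH t q j a h M Hh Hq HM HT).
      assert (BD := HMk _ a h (C * M) Hh (blossom_is_poly t e q s j Hq ltac:(lia)) B x Hx).
      specialize (B x Hx).
      change (blossom t e q (S s) j) with
        (polar (e - s) (t (j + Z.of_nat (S s))%Z) (blossom t e q s j)).
      set (g := blossom t e q s j) in *; unfold polar.
      specialize (HT (S s) ltac:(lia)); set (u := t _) in *.
      apply Rle_trans with (1 := Rabs_triang _ _).
      assert (Hu : Rabs (u - x) <= (K + 1) * h).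
      { replace (u - x) with ((u - a) + - (x - a)) by ring.
        apply Rle_trans with (1 := Rabs_triang _ _).
        rewrite Rabs_Ropp, (Rabs_pos_eq (x - a)) by lra; lra. }
      assert (HN : 1 <= INR (e - s)) by (apply (le_INR 1); lia).
      unfold Rdiv; rewrite !Rabs_mult.
      rewrite (Rabs_pos_eq (/ INR (e - s))) by (left; apply Rinv_0_lt_compat; lra).
      assert (Hi : / INR (e - s) <= 1).
      { rewrite <- Rinv_1; apply Rinv_le_contravar; lra. }
      assert (H0 : Rabs (u - x) * Rabs (Derive g x) <= ((K + 1) * h) * (C' * (C * M) / h))
        by (apply Rmult_le_compat; auto using Rabs_pos).
      replace (((K + 1) * h) * (C' * (C * M) / h)) with ((K + 1) * (C' * C) * M) in H0
        by (field; lra).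
      assert (H1 : 0 <= Rabs (u - x) * Rabs (Derive g x))
        by (apply Rmult_le_pos; apply Rabs_pos).
      assert (Rabs (u - x) * Rabs (Derive g x) * / INR (e - s)
        <= Rabs (u - x) * Rabs (Derive g x) * 1) by (now apply Rmult_le_compat_l).
      lra. }
  destruct (H e ltac:(lia)) as [C [HC HB]].
  exists C; split; [exact HC|].
  intros t q j a h M Hh Hq HM HT.
  assert (B := HB t q j a h M Hh Hq HM HT a ltac:(lra)).
  assert (H1 := blossom_is_poly t e q e j Hq ltac:(lia)).
  rewrite Nat.sub_diag in H1; destruct (is_poly_S_inv _ _ H1) as [c [g [Hg E]]].
  unfold coef; rewrite E, (is_poly_0_inv _ Hg); rewrite E, (is_poly_0_inv _ Hg) in B.
  now rewrite Rmult_0_r in *.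
Qed.

(** * Splines from B-spline coefficients *)

Lemma knot_seq_lt z n : knot_seq z n -> forall a b : nat, (a < b <= n)%nat -> z b < z a.
Proof.
  intros [_ [_ H]] a b; induction b as [|b IH]; intros Hab; [lia|].
  assert (H1 := H b ltac:(lia)).
  destruct (Nat.eq_dec a b) as [->|Hne]; [exact H1|].
  apply Rlt_trans with (1 := H1), IH; lia.
Qed.

Lemma knot_seq_pos z n : knot_seq z n -> (1 <= n)%nat.
Proof. intros [H1 [H2 _]]; destruct n; [lra | lia]. Qed.

Lemma zext_nat z n (i : nat) : (i <= n)%nat -> zext z n (Z.of_nat i) = z i.
Proof.
  intros Hi; unfold zext.
  destruct (Z.ltb_spec (Z.of_nat i) 0); [lia|].
  destruct (Z.ltb_spec (Z.of_nat n) (Z.of_nat i)); [lia|].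
  now rewrite Nat2Z.id.
Qed.

Lemma zext_low z n i : knot_seq z n -> (i <= 0)%Z -> zext z n i = 1.
Proof.
  intros [H0 _] Hi; unfold zext.
  destruct (Z.ltb_spec i 0); [reflexivity|].
  replace i with (Z.of_nat 0) by lia.
  destruct (Z.ltb_spec (Z.of_nat n) (Z.of_nat 0)); [lia|].
  now rewrite Nat2Z.id.
Qed.

Lemma zext_high z n i : knot_seq z n -> (Z.of_nat n <= i)%Z -> zext z n i = -1.
Proof.
  intros Hk Hi; assert (Hn := knot_seq_pos _ _ Hk); destruct Hk as [_ [H1 _]]; unfold zext.
  destruct (Z.ltb_spec i 0); [lia|].
  destruct (Z.ltb_spec (Z.of_nat n) i); [reflexivity|].
  replace i with (Z.of_nat n) by lia; now rewrite Nat2Z.id.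
Qed.

Lemma zext_lt z n a b : knot_seq z n -> (a < b)%Z -> (a < Z.of_nat n)%Z -> (0 < b)%Z ->
  zext z n b < zext z n a.
Proof.
  intros Hk Hab Ha Hb; assert (Hn := knot_seq_pos _ _ Hk).
  assert (Ea : zext z n a = z (Z.to_nat a)).
  { destruct (Z_lt_le_dec a 0).
    - rewrite zext_low by (assumption || lia).
      replace (Z.to_nat a) with 0%nat by lia; symmetry; apply Hk.
    - rewrite <- (Z2Nat.id a) at 1 by assumption; apply zext_nat; lia. }
  assert (Eb : zext z n b = z (Nat.min n (Z.to_nat b))).
  { destruct (Z_lt_le_dec (Z.of_nat n) b).
    - rewrite zext_high by (assumption || lia).
      replace (Nat.min n (Z.to_nat b)) with n by lia; symmetry; apply Hk.
    - rewrite <- (Z2Nat.id b) at 1 by lia; rewrite zext_nat by lia; f_equal; lia. }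
  rewrite Ea, Eb; apply (knot_seq_lt z n Hk); lia.
Qed.

Lemma zext_antitone z n : knot_seq z n -> antitone (zext z n).
Proof.
  intros Hk a b Hab; assert (Hn := knot_seq_pos _ _ Hk).
  destruct (Z.eq_dec a b) as [->|]; [lra|].
  destruct (Z_lt_le_dec a (Z.of_nat n)); [|rewrite !zext_high by (assumption || lia); lra].
  destruct (Z_lt_le_dec 0 b); [|rewrite !zext_low by (assumption || lia); lra].
  left; apply zext_lt; auto; lia.
Qed.

Lemma zext_bounds z n i : knot_seq z n -> -1 <= zext z n i <= 1.
Proof.
  intros Hk; assert (H := zext_antitone z n Hk); split.
  - rewrite <- (zext_high z n (Z.max i (Z.of_nat n)) Hk) by lia; apply H; lia.
  - rewrite <- (zext_low z n (Z.min i 0) Hk) by lia; apply H; lia.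
Qed.

Lemma zext_locate z n x : knot_seq z n -> -1 <= x <= 1 ->
  exists i : nat, (i < n)%nat /\ zext z n (Z.of_nat i + 1) <= x <= zext z n (Z.of_nat i).
Proof.
  intros Hk Hx; assert (Hn := knot_seq_pos _ _ Hk).
  assert (H : forall m, (m <= n)%nat -> z m <= x -> x <= z 0%nat -> (1 <= m)%nat ->
    exists i : nat, (i < m)%nat /\ z (S i) <= x <= z i).
  { induction m as [|m IH]; intros Hm H1 H2 H3; [lia|].
    destruct (Rle_dec x (z m)) as [H|H]; [exists m; split; [lia | lra]|].
    destruct m as [|m]; [lra|].
    destruct IH as [i [Hi Hi']]; [lia | lra | exact H2 | lia |].
    exists i; split; [lia | exact Hi']. }
  destruct Hk as [H0 [H1 _]].
  destruct (H n) as [i [Hi Hi']]; [lia | lra | lra | lia |].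
  exists i; split; [exact Hi|].
  replace (Z.of_nat i + 1)%Z with (Z.of_nat (S i)) by lia.
  rewrite !zext_nat by lia; exact Hi'.
Qed.

(** * Truncated powers and a global formula for splines *)

Lemma is_derive_of_quadratic (f : R -> R) (x l : R) :
  (forall v, Rabs (f v - f x - l * (v - x)) <= (v - x) * (v - x)) -> is_derive f x l.
Proof.
  intros H; apply is_derive_Reals; intros eps Heps.
  exists (mkposreal eps Heps); intros h Hh0 Hh; simpl in Hh.
  replace ((f (x + h) - f x) / h - l) with ((f (x + h) - f x - l * (x + h - x)) / h)
    by (field; exact Hh0).
  unfold Rdiv; rewrite Rabs_mult, Rabs_inv.
  apply Rle_lt_trans with (2 := Hh).
  apply Rmult_le_reg_r with (Rabs h); [now apply Rabs_pos_lt|].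
  rewrite Rmult_assoc, Rinv_l, Rmult_1_r by (now apply Rabs_no_R0).
  apply Rle_trans with (1 := H (x + h)).
  rewrite <- Rabs_mult; apply Rle_trans with (2 := Rle_abs _); right; ring.
Qed.

(** [Rmin u 0 ^ n] is the truncated power living on the left of 0: pieces of larger index lie to the
    left, since the knots decrease. *)
Lemma is_derive_Rmin_pow n (u : R) : (2 <= n)%nat ->
  is_derive (fun u => Rmin u 0 ^ n) u (INR n * Rmin u 0 ^ (n - 1)).
Proof.
  intros Hn; induction n as [|n IH]; [lia|].
  destruct (Nat.eq_dec n 1) as [->|Hn1].
  - apply is_derive_of_quadratic; intros v; simpl.
    assert (Hsq := Rle_0_sqr (v - u)); assert (Hv2 := Rle_0_sqr v).
    assert (Hu2 := Rle_0_sqr u); unfold Rsqr in *.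
    unfold Rmin; destruct (Rle_dec v 0) as [Hv|Hv], (Rle_dec u 0) as [Hu|Hu];
      try apply Rnot_le_lt in Hv; try apply Rnot_le_lt in Hu; apply Rabs_le.
    + split; nra.
    + assert (u * v <= 0) by nra; split; nra.
    + assert (u * v <= 0) by nra; split; nra.
    + split; nra.
  - assert (E : forall m v, (1 <= m)%nat -> Rmin v 0 ^ S m = v * Rmin v 0 ^ m).
    { intros m v Hm; unfold Rmin; destruct (Rle_dec v 0); [reflexivity|].
      rewrite !pow_i by lia; ring. }
    apply is_derive_ext_R with (fun v => v * Rmin v 0 ^ n); [intros; symmetry; apply E; lia|].
    replace (S n - 1)%nat with n by lia.
    assert (H := IH ltac:(lia)).
    replace (INR (S n) * Rmin u 0 ^ n) with
      (1 * Rmin u 0 ^ n + u * (INR n * Rmin u 0 ^ (n - 1))).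
    + apply (is_derive_mult (fun v => v) (fun v => Rmin v 0 ^ n));
        [apply (is_derive_id (K := R_AbsRing)) | exact H | intros; apply Rmult_comm].
    + rewrite S_INR.
      replace (Rmin u 0 ^ n) with (u * Rmin u 0 ^ (n - 1)); [ring|].
      rewrite <- E by lia; f_equal; lia.
Qed.

Lemma continuous_Rmin_pow n (u : R) : (1 <= n)%nat -> continuous (fun u => Rmin u 0 ^ n) u.
Proof.
  intros Hn; destruct (Nat.eq_dec n 1) as [->|Hn1].
  - apply filterlim_locally; intros eps; exists eps; intros v Hv.
    unfold ball in *; simpl in *; unfold AbsRing_ball, abs, minus, plus, opp in *; simpl in *.
    apply Rle_lt_trans with (2 := Hv); rewrite !Rmult_1_r.
    unfold Rmin; destruct (Rle_dec v 0), (Rle_dec u 0);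
      apply Rabs_le; unfold Rabs; destruct (Rcase_abs (v + - u)); lra.
  - apply (ex_derive_continuous (K := R_AbsRing) (V := R_NormedModule)).
    exists (INR n * Rmin u 0 ^ (n - 1)); apply is_derive_Rmin_pow; lia.
Qed.

Lemma cont_within_of_continuous a b g (x : R) : continuous g x -> cont_within a b g x.
Proof.
  intros H; unfold cont_within.
  apply filterlim_filter_le_1 with (2 := H); apply filter_le_within.
Qed.

Lemma deriv_within_of_is_derive a b g (x l : R) : is_derive g x l -> deriv_within a b g x l.
Proof.
  intros H; apply is_derive_Reals in H.
  apply filterlim_locally; intros eps.
  destruct (H eps (cond_pos eps)) as [d Hd]; exists d; intros y' Hy [_ Hne].
  set (y := y' : R); change (ball x d y) in Hy; change (y <> x) in Hne.
  change (ball l eps ((g y - g x) / (y - x))); clearbody y; clear y'.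
  specialize (Hd (y - x)); replace (x + (y - x)) with y in Hd by ring.
  apply Hd; [lra | exact Hy].
Qed.

(** The sum runs from 1 and may be empty, unlike [sum_f_R0]: the summands belong to the interior
    knots, and there may be none. *)
Fixpoint psum (F : nat -> R) (n : nat) : R :=
  match n with O => 0 | S n' => psum F n' + F n end.

Lemma psum_truncate F G i n : (i <= n)%nat -> (forall s, (1 <= s <= i)%nat -> F s = G s) ->
  (forall s, (i < s <= n)%nat -> F s = 0) -> psum F n = psum G i.
Proof.
  intros Hin HG H0; induction n as [|n IH].
  - replace i with 0%nat by lia; reflexivity.
  - destruct (Nat.eq_dec i (S n)) as [->|Hne].
    + assert (H : forall m, (m <= S n)%nat -> psum F m = psum G m).
      { induction m as [|m IHm]; intros Hm; [reflexivity|].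
        simpl; rewrite IHm, HG by lia; reflexivity. }
      apply H; lia.
    + simpl; rewrite H0, IH by (lia || (intros; apply H0; lia)); ring.
Qed.

Lemma psum_derive (F G : nat -> R -> R) n (x : R) :
  (forall s, is_derive (F s) x (G s x)) ->
  is_derive (fun u => psum (fun s => F s u) n) x (psum (fun s => G s x) n).
Proof.
  intros H; induction n as [|n IH]; simpl.
  - apply (is_derive_const (V := R_NormedModule)).
  - apply (is_derive_plus (V := R_NormedModule)); [exact IH | apply H].
Qed.

Lemma psum_continuous (F : nat -> R -> R) n (x : R) : (forall s, continuous (F s) x) ->
  continuous (fun u => psum (fun s => F s u) n) x.
Proof.
  intros H; induction n as [|n IH]; simpl; [apply continuous_const|].
  apply (continuous_plus (V := R_NormedModule)); [exact IH | apply H].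
Qed.

Fixpoint falling (e l : nat) : R :=
  match l with O => 1 | S l' => falling e l' * INR (e - l') end.

Lemma Derive_n_plus_pow m f g t e l : is_poly m f -> (l <= e)%nat ->
  Derive_n (fun x => f x + g * (x - t) ^ e) l =
  fun x => Derive_n f l x + g * (falling e l * (x - t) ^ (e - l)).
Proof.
  intros Hf; induction l as [|l IH]; intros Hl; apply functional_extensionality; intros x.
  - simpl; rewrite Nat.sub_0_r; ring.
  - change (Derive (Derive_n (fun x => f x + g * (x - t) ^ e) l) x =
      Derive (Derive_n f l) x + g * (falling e (S l) * (x - t) ^ (e - S l))).
    rewrite IH by lia; apply is_derive_unique.
    assert (D := is_poly_ex_derive _ _ x (is_poly_Derive_n m f l Hf)).
    revert D; generalize (Derive_n f l); intros f' D.
    auto_derive; [exact D|].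
    change (Derive (fun u : R => f' u) x) with (Derive f' x).
    change (falling e (S l)) with (falling e l * INR (e - l)).
    replace (Nat.pred (e - l)) with (e - S l)%nat by lia; unfold Rminus; ring.
Qed.

(** By [db_jump] the spline is its rightmost piece plus one truncated power for each interior knot.
    This single formula is smooth on the whole line, so no gluing of pieces is needed to obtain the
    derivatives; those of order below e have truncated powers of positive exponent and are
    continuous. *)
Lemma spline_of_coefs e z n (c : Z -> R) : (1 <= e)%nat -> knot_seq z n ->
  exists (S : R -> R) (DS : nat -> R -> R),
    Sigma (1 + e) z n S /\ Cr_derivs (-1) 1 (e - 1) S DS /\
    (forall x, DS 0%nat x = S x) /\
    forall (i l : nat) x, (i < n)%nat -> (l < e)%nat ->
      zext z n (Z.of_nat i + 1) <= x <= zext z n (Z.of_nat i) ->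
      DS l x = Derive_n (db (zext z n) e c e (Z.of_nat i)) l x.
Proof.
  intros He Hk; assert (Hn := knot_seq_pos _ _ Hk).
  set (t := zext z n); set (p := fun i : nat => db t e c e (Z.of_nat i)).
  set (T := fun s : nat => t (Z.of_nat s)).
  (* The jump is a multiple of [(x - T i) ^ e], whose value at [T i + 1] is 1. *)
  set (gam := fun s : nat => p s (T s + 1) - p (s - 1)%nat (T s + 1)).
  assert (Hjump : forall i x, (1 <= i < n)%nat ->
    p i x = p (i - 1)%nat x + gam i * (x - T i) ^ e).
  { intros i x Hi.
    destruct (db_jump t e c (Z.of_nat i)) as [g Hg].
    - intros a b Hab Hlt Heq.
      assert (t b < t a) by (apply zext_lt; auto; lia); lra.
    - assert (Hg' : forall x, p i x - p (i - 1)%nat x = g * (x - T i) ^ e).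
      { intros u; unfold p; replace (Z.of_nat (i - 1)) with (Z.of_nat i - 1)%Z by lia.
        apply Hg. }
      assert (Eg : gam i = g).
      { unfold gam; rewrite Hg'.
        replace (T i + 1 - T i) with 1 by ring; rewrite pow1; ring. }
      specialize (Hg' x); rewrite Eg; lra. }
  assert (Hpoly : forall i, is_poly (1 + e) (p i)) by (intros i; apply db_is_poly).
  assert (Hp : forall i l x, (i < n)%nat -> (l < e)%nat -> Derive_n (p i) l x =
    Derive_n (p 0%nat) l x + psum (fun s => gam s * (falling e l * (x - T s) ^ (e - l))) i).
  { intros i l x Hi Hl; induction i as [|i IH]; [simpl; ring|].
    simpl psum; rewrite <- Rplus_assoc, <- IH by lia.
    replace (p (S i)) with (fun x => p i x + gam (S i) * (x - T (S i)) ^ e).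
    - now rewrite (Derive_n_plus_pow (1 + e)) by (apply Hpoly || lia).
    - apply functional_extensionality; intros u; rewrite (Hjump (S i)) by lia.
      replace (S i - 1)%nat with i by lia; reflexivity. }
  set (DS := fun l x => Derive_n (p 0%nat) l x +
    psum (fun s => gam s * (falling e l * Rmin (x - T s) 0 ^ (e - l))) (n - 1)).
  assert (HDS : forall (i l : nat) x, (i < n)%nat -> (l < e)%nat ->
      t (Z.of_nat i + 1)%Z <= x <= t (Z.of_nat i) -> DS l x = Derive_n (p i) l x).
  { intros i l x Hi Hl Hx; rewrite Hp by assumption; unfold DS; f_equal.
    apply psum_truncate; [lia | |].
    - intros s Hs; assert (t (Z.of_nat i) <= T s) by (apply zext_antitone; [assumption | lia]).
      rewrite Rmin_left by lra; reflexivity.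
    - intros s Hs.
      assert (T s <= t (Z.of_nat i + 1)%Z) by (apply zext_antitone; [assumption | lia]).
      rewrite Rmin_right, pow_i by (lra || lia); ring. }
  assert (Hdiff : forall s (x : R), is_derive (fun u => u - T s) x 1).
  { intros s x; auto_derive; [easy | ring]. }
  assert (HD : forall l (x : R), (l < e - 1)%nat -> is_derive (DS l) x (DS (S l) x)).
  { intros l x Hl; unfold DS; apply (is_derive_plus (V := R_NormedModule)).
    - apply Derive_correct, (is_poly_ex_derive (1 + e)), is_poly_Derive_n, Hpoly.
    - apply (psum_derive (fun s u => gam s * (falling e l * Rmin (u - T s) 0 ^ (e - l)))
        (fun s u => gam s * (falling e (S l) * Rmin (u - T s) 0 ^ (e - S l)))).
      intros s.
      replace (gam s * (falling e (S l) * Rmin (x - T s) 0 ^ (e - S l))) with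
        (gam s * (falling e l * (1 * (INR (e - l) * Rmin (x - T s) 0 ^ (e - l - 1))))).
      + apply (is_derive_scal (fun u => falling e l * Rmin (u - T s) 0 ^ (e - l))).
        apply (is_derive_scal (fun u => Rmin (u - T s) 0 ^ (e - l))).
        apply (is_derive_comp (fun v => Rmin v 0 ^ (e - l)) (fun u => u - T s));
          [apply is_derive_Rmin_pow; lia | apply Hdiff].
      + change (falling e (S l)) with (falling e l * INR (e - l)).
        replace (e - S l)%nat with (e - l - 1)%nat by lia; ring. }
  assert (HC : forall l (x : R), (l < e)%nat -> continuous (DS l) x).
  { intros l x Hl; unfold DS; apply (continuous_plus (V := R_NormedModule)).
    - apply (is_poly_continuous (1 + e)), is_poly_Derive_n, Hpoly.
    - apply (psum_continuous (fun s u => gam s * (falling e l * Rmin (u - T s) 0 ^ (e - l)))).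
      intros s.
      apply (continuous_scal_r (V := R_NormedModule) (gam s)
        (fun u => falling e l * Rmin (u - T s) 0 ^ (e - l))).
      apply (continuous_scal_r (V := R_NormedModule) (falling e l)
        (fun u => Rmin (u - T s) 0 ^ (e - l))).
      apply (continuous_comp (fun u => u - T s) (fun v => Rmin v 0 ^ (e - l)));
        [|apply continuous_Rmin_pow; lia].
      apply (ex_derive_continuous (K := R_AbsRing) (V := R_NormedModule)).
      exists 1; apply Hdiff. }
  exists (DS 0%nat), DS; split; [split|split; [split; [|split]|split]].
  - intros x _; apply cont_within_of_continuous, HC; lia.
  - intros j Hj; destruct (Hpoly (j - 1)%nat) as [cs [Hl Hcs]].
    exists cs; split; [exact Hl|].
    intros x Hx; rewrite <- Hcs.
    apply (HDS (j - 1)%nat 0%nat); [lia | lia |].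
    replace (Z.of_nat (j - 1) + 1)%Z with (Z.of_nat j) by lia.
    unfold t; rewrite !zext_nat by lia.
    replace (j - 1)%nat with (Nat.pred j) by lia; exact Hx.
  - reflexivity.
  - intros l Hl x _; apply deriv_within_of_is_derive, HD, Hl.
  - intros x _; apply cont_within_of_continuous, HC; lia.
  - reflexivity.
  - exact HDS.
Qed.

(** * One-sided Hermite approximation *)

(** Composition with [clamp] extends a function continuous on [-1, 1] to one continuous on the line,
    as [whitney] and [taylor_poly] require. *)
Definition clamp (x : R) : R := Rmax (-1) (Rmin x 1).

Lemma clamp_bounds x : -1 <= clamp x <= 1.
Proof. unfold clamp, Rmax, Rmin; destruct (Rle_dec x 1), (Rle_dec _ _); lra. Qed.

Lemma clamp_id x : -1 <= x <= 1 -> clamp x = x.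
Proof. intros H; unfold clamp, Rmax, Rmin; destruct (Rle_dec x 1), (Rle_dec _ _); lra. Qed.

Lemma clamp_lipschitz x y : Rabs (clamp y - clamp x) <= Rabs (y - x).
Proof.
  unfold clamp, Rmax, Rmin.
  destruct (Rle_dec x 1), (Rle_dec y 1); repeat destruct (Rle_dec _ _);
    apply Rabs_le; unfold Rabs; destruct (Rcase_abs (y - x)); lra.
Qed.

Lemma cont_within_eps a b g x : cont_within a b g x -> forall eps, 0 < eps ->
  exists d, 0 < d /\ forall y, a <= y <= b -> Rabs (y - x) < d -> Rabs (g y - g x) < eps.
Proof.
  intros H eps Heps.
  destruct (proj1 (filterlim_locally _ _) H (mkposreal eps Heps)) as [d Hd].
  exists d; split; [apply cond_pos|].
  intros y Hy Hyx; exact (Hd y Hyx Hy).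
Qed.

Lemma deriv_within_eps a b g x l : deriv_within a b g x l -> forall eps, 0 < eps ->
  exists d, 0 < d /\ forall y, a <= y <= b -> y <> x -> Rabs (y - x) < d ->
    Rabs ((g y - g x) / (y - x) - l) < eps.
Proof.
  intros H eps Heps.
  destruct (proj1 (filterlim_locally _ _) H (mkposreal eps Heps)) as [d Hd].
  exists d; split; [apply cond_pos|].
  intros y Hy Hne Hyx; exact (Hd y Hyx (conj Hy Hne)).
Qed.

Lemma deriv_within_cont_within a b g x l : deriv_within a b g x l -> cont_within a b g x.
Proof.
  intros H; destruct (deriv_within_eps _ _ _ _ _ H 1 Rlt_0_1) as [d [Hd Hq]].
  apply filterlim_locally; intros eps.
  assert (HL : 0 < Rabs l + 1) by (assert (H1 := Rabs_pos l); lra).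
  assert (He : 0 < eps / (Rabs l + 1)) by (apply Rdiv_lt_0_compat; [apply cond_pos | lra]).
  assert (Hm : 0 < Rmin d (eps / (Rabs l + 1))) by (now apply Rmin_glb_lt).
  exists (mkposreal _ Hm); intros y' Hy Hab.
  set (y := y' : R); change (Rabs (y - x) < Rmin d (eps / (Rabs l + 1))) in Hy.
  change (a <= y <= b) in Hab; change (Rabs (g y - g x) < eps); clearbody y; clear y'.
  destruct (Req_dec y x) as [->|Hne].
  { replace (g x - g x) with 0 by ring; rewrite Rabs_R0; apply cond_pos. }
  assert (H1 := Hq y Hab Hne (Rlt_le_trans _ _ _ Hy (Rmin_l _ _))).
  assert (H2 := Rlt_le_trans _ _ _ Hy (Rmin_r _ _)).
  set (q := (g y - g x) / (y - x)) in *.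
  replace (g y - g x) with (q * (y - x)) by (unfold q; field; lra).
  assert (Hql : Rabs q < Rabs l + 1).
  { replace q with ((q - l) + l) by ring.
    apply Rle_lt_trans with (1 := Rabs_triang _ _); lra. }
  rewrite Rabs_mult.
  apply Rle_lt_trans with ((Rabs l + 1) * Rabs (y - x)).
  - apply Rmult_le_compat_r; [apply Rabs_pos | lra].
  - apply (Rmult_lt_compat_l (Rabs l + 1)) in H2; [|lra].
    replace ((Rabs l + 1) * (eps / (Rabs l + 1))) with (pos eps) in H2 by (field; lra).
    exact H2.
Qed.

Lemma deriv_within_is_derive a b g x l : a < x < b -> deriv_within a b g x l ->
  is_derive g x l.
Proof.
  intros Hx H; apply is_derive_Reals; intros eps Heps.
  destruct (deriv_within_eps _ _ _ _ _ H eps Heps) as [d [Hd Hq]].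
  assert (Hm : 0 < Rmin d (Rmin (x - a) (b - x))) by (repeat apply Rmin_glb_lt; lra).
  exists (mkposreal _ Hm); intros h Hh0 Hh; simpl in Hh.
  assert (H1 := Rlt_le_trans _ _ _ Hh (Rmin_l _ _)).
  assert (H2 := Rlt_le_trans _ _ _ Hh (Rmin_r _ _)).
  assert (H3 := Rlt_le_trans _ _ _ H2 (Rmin_l _ _)).
  assert (H4 := Rlt_le_trans _ _ _ H2 (Rmin_r _ _)).
  apply Rabs_def2 in H3; apply Rabs_def2 in H4.
  specialize (Hq (x + h)); replace (x + h - x) with h in Hq by ring.
  apply Hq; [lra | lra | exact H1].
Qed.

Lemma cont_clamp g : (forall x, -1 <= x <= 1 -> cont_within (-1) 1 g x) ->
  cont (fun x => g (clamp x)).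
Proof.
  intros H x; apply filterlim_locally; intros eps.
  destruct (cont_within_eps _ _ _ _ (H (clamp x) (clamp_bounds x)) eps (cond_pos eps))
    as [d [Hd Hg]].
  exists (mkposreal d Hd); intros y Hy.
  apply Hg; [apply clamp_bounds|].
  apply Rle_lt_trans with (1 := clamp_lipschitz x y), Hy.
Qed.

Lemma is_derive_clamp g x l : -1 < x < 1 -> deriv_within (-1) 1 g x l ->
  is_derive (fun u => g (clamp u)) x l.
Proof.
  intros Hx H; apply (is_derive_ext_loc (K := R_AbsRing) (V := R_NormedModule) g).
  - assert (Hm : 0 < Rmin (x + 1) (1 - x)) by (apply Rmin_glb_lt; lra).
    exists (mkposreal _ Hm); intros y Hy.
    change (Rabs (y - x) < Rmin (x + 1) (1 - x)) in Hy.
    assert (H3 := Rlt_le_trans _ _ _ Hy (Rmin_l _ _)).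
    assert (H4 := Rlt_le_trans _ _ _ Hy (Rmin_r _ _)).
    apply Rabs_def2 in H3; apply Rabs_def2 in H4.
    rewrite clamp_id; [reflexivity | lra].
  - now apply deriv_within_is_derive with (-1) 1.
Qed.

(** * The modulus of smoothness on subintervals *)

Lemma fdiff_points k h x a b l : 0 < h -> a <= x -> x + INR k * h <= b -> (l <= k)%nat ->
  a <= x + INR l * h <= b.
Proof.
  intros Hh Ha Hb Hl.
  assert (0 <= INR l <= INR k) by (split; [apply pos_INR | now apply le_INR]).
  nra.
Qed.

Lemma fdiff_bounded k g :
  (forall x, -1 <= x <= 1 -> cont_within (-1) 1 g x) ->
  exists B, forall h x, 0 < h -> -1 <= x -> x + INR k * h <= 1 ->
  Rabs (fdiff k h g x) <= B.
Proof.
  intros Hg; assert (Hc := cont_clamp g Hg).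
  assert (Hc' : forall x, -1 <= x <= 1 -> continuity_pt (fun x => g (clamp x)) x)
    by (intros x _; apply continuity_pt_filterlim, Hc).
  destruct (continuity_ab_maj _ (-1) 1 ltac:(lra) Hc') as [u [Hu _]].
  destruct (continuity_ab_min _ (-1) 1 ltac:(lra) Hc') as [v [Hv _]].
  set (B := Rmax (g (clamp u)) (- g (clamp v))).
  assert (HB : forall x, -1 <= x <= 1 -> Rabs (g x) <= B).
  { intros x Hx; rewrite <- (clamp_id x) by exact Hx; specialize (Hu x Hx); specialize (Hv x Hx).
    assert (H1 := Rmax_l (g (clamp u)) (- g (clamp v))).
    assert (H2 := Rmax_r (g (clamp u)) (- g (clamp v))).
    apply Rabs_le; unfold B; lra. }
  exists (sum_f_R0 (fun l => Rabs ((-1) ^ (k - l) * Binomial.C k l) * B) k).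
  intros h x Hh Hx Hxh; unfold fdiff.
  apply Rle_trans with (1 := Rsum_abs _ _).
  apply sum_Rle; intros l Hl; rewrite Rabs_mult.
  apply Rmult_le_compat_l; [apply Rabs_pos|].
  apply HB; now apply (fdiff_points k h x (-1) 1).
Qed.

(** [real] sends an infinite supremum to 0, so [omega] has its meaning only once the set of
    differences is known to be nonempty and bounded; boundedness comes from continuity on the
    compact interval [-1, 1]. *)
Lemma omega_is_lub k g (Hk : (1 <= k)%nat)
  (Hg : forall x, -1 <= x <= 1 -> cont_within (-1) 1 g x) a b :
  -1 <= a -> a < b -> b <= 1 ->
  is_lub_Rbar (fun v => exists h x, 0 < h <= b - a /\ a <= x /\ x + INR k * h <= b
                                   /\ v = Rabs (fdiff k h g x))
    (omega k g (b - a) a b).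
Proof.
  intros Ha Hab Hb; unfold omega.
  set (E := fun v => _).
  assert (H := Lub_Rbar_correct E).
  destruct (fdiff_bounded k g Hg) as [B HB].
  assert (HK : 1 <= INR k) by (apply (le_INR 1); exact Hk).
  assert (Hne : exists v, E v).
  { exists (Rabs (fdiff k ((b - a) / INR k) g a)), ((b - a) / INR k), a.
    assert (E1 : INR k * ((b - a) / INR k) = b - a) by (field; lra).
    assert (H0 : 0 < (b - a) / INR k) by (apply Rdiv_lt_0_compat; lra).
    repeat split; [exact H0 | nra | lra | lra]. }
  assert (Hub : is_ub_Rbar E B).
  { intros v [h [x [H1 [H2 [H3 ->]]]]]; simpl; apply HB; lra. }
  destruct Hne as [v Hv].
  assert (L1 := proj2 H _ Hub); assert (L2 := proj1 H _ Hv).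
  destruct (Lub_Rbar E) as [L| |]; simpl in *; [exact H | contradiction | contradiction].
Qed.

(** With the length of the window as second argument, the restriction on the step follows from k h
    <= b - a. *)
Lemma fdiff_le_omega k g (Hk : (1 <= k)%nat)
  (Hg : forall x, -1 <= x <= 1 -> cont_within (-1) 1 g x) a b h x :
  -1 <= a -> b <= 1 -> 0 < h -> a <= x -> x + INR k * h <= b ->
  Rabs (fdiff k h g x) <= omega k g (b - a) a b.
Proof.
  intros Ha Hb Hh Hx Hxh.
  assert (HK : 1 <= INR k) by (apply (le_INR 1); exact Hk).
  assert (h <= INR k * h) by nra.
  apply (proj1 (omega_is_lub k g Hk Hg a b Ha ltac:(lra) Hb)).
  exists h, x; repeat split; lra.
Qed.

Lemma omega_nonneg k g (Hk : (1 <= k)%nat)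
  (Hg : forall x, -1 <= x <= 1 -> cont_within (-1) 1 g x) a b :
  -1 <= a -> a < b -> b <= 1 -> 0 <= omega k g (b - a) a b.
Proof.
  intros Ha Hab Hb.
  assert (HK : 1 <= INR k) by (apply (le_INR 1); exact Hk).
  apply Rle_trans with (1 := Rabs_pos (fdiff k ((b - a) / INR k) g a)).
  apply fdiff_le_omega; auto; try lra; [apply Rdiv_lt_0_compat; lra|].
  right; field; lra.
Qed.

Lemma omega_mono k g (Hk : (1 <= k)%nat)
  (Hg : forall x, -1 <= x <= 1 -> cont_within (-1) 1 g x) a b a' b' :
  -1 <= a' -> a' <= a -> a < b -> b <= b' -> b' <= 1 ->
  omega k g (b - a) a b <= omega k g (b' - a') a' b'.
Proof.
  intros H1 H2 H3 H4 H5.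
  apply (proj2 (omega_is_lub k g Hk Hg a b ltac:(lra) H3 ltac:(lra))
    (Finite (omega k g (b' - a') a' b'))).
  intros v [h [x [Hh [Hx [Hxh ->]]]]]; simpl.
  apply fdiff_le_omega; auto; lra.
Qed.

Lemma Cr_derivs_cont_within r f Df : Cr_derivs (-1) 1 r f Df ->
  forall i x, (i <= r)%nat -> -1 <= x <= 1 -> cont_within (-1) 1 (Df i) x.
Proof.
  intros [_ [HD HC]] i x Hi Hx; destruct (Nat.eq_dec i r) as [->|Hne]; [now apply HC|].
  apply deriv_within_cont_within with (Df (S i) x), HD; [lia | exact Hx].
Qed.

(** Whitney's theorem for the r-th derivative, integrated r times from [tau]. The bound keeps the
    power of the distance to [tau], for only a remainder vanishing at [tau] can be dominated there
    by a power of x - tau. *)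
Lemma hermite_whitney k r : (1 <= k)%nat -> exists C, 0 <= C /\ forall f Df a b tau,
  Cr_derivs (-1) 1 r f Df -> -1 <= a -> a < b -> b <= 1 -> a <= tau <= b ->
  exists P, is_poly (k + r) P /\ (forall l, (l < r)%nat -> Derive_n P l tau = Df l tau) /\
    forall x, a <= x <= b ->
      Rabs (f x - P x) <= C * omega k (Df r) (b - a) a b * Rabs (x - tau) ^ r.
Proof.
  intros Hk; destruct (whitney k Hk) as [C [HC HW]].
  exists C; split; [exact HC|].
  intros f Df a b tau Hf Ha Hab Hb Htau.
  assert (Hcw := Cr_derivs_cont_within r f Df Hf).
  assert (Hg := fun x => Hcw r x (Nat.le_refl r)).
  assert (Hom := omega_nonneg k (Df r) Hk Hg a b Ha Hab Hb).
  destruct (HW (fun x => Df r (clamp x)) a b (omega k (Df r) (b - a) a b))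
    as [Q [HQ BQ]]; auto.
  { now apply cont_clamp. }
  { intros h x Hh Hx Hxh.
    replace (fdiff k h (fun x => Df r (clamp x)) x) with (fdiff k h (Df r) x).
    - now apply fdiff_le_omega.
    - unfold fdiff; apply sum_eq; intros l Hl; rewrite clamp_id; [reflexivity|].
      assert (a <= x + INR l * h <= b) by (now apply (fdiff_points k)); lra. }
  destruct (taylor_poly r k (fun i x => Df i (clamp x)) a b tau Q
    (C * omega k (Df r) (b - a) a b)) as [P [HP [DP BP]]]; auto.
  - intros i x Hi; apply cont_clamp; intros; now apply Hcw.
  - intros i x Hi Hx.
    apply is_derive_clamp; [lra|].
    rewrite clamp_id by lra; apply Hf; [exact Hi | lra].
  - now apply Rmult_le_pos.
  - exists P; split; [exact HP|]; split.
    + intros l Hl; rewrite DP, clamp_id by (assumption || lra); reflexivity.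
    + intros x Hx; specialize (BP x Hx); simpl in BP; rewrite clamp_id in BP by lra.
      rewrite <- (proj1 Hf) by lra; exact BP.
Qed.

Lemma one_sided_hermite k r f Df C : (1 <= k)%nat -> Cr_derivs (-1) 1 r f Df -> 0 <= C ->
  (forall a b tau, -1 <= a -> a < b -> b <= 1 -> a <= tau <= b ->
    exists P, is_poly (k + r) P /\ (forall l, (l < r)%nat -> Derive_n P l tau = Df l tau) /\
    forall x, a <= x <= b ->
      Rabs (f x - P x) <= C * omega k (Df r) (b - a) a b * Rabs (x - tau) ^ r) ->
  forall a b tau r' s, -1 <= a -> a < b -> b <= 1 -> a <= tau <= b ->
  (r' = r \/ S r' = r) -> Rabs s = 1 ->
  exists P, is_poly (k + r) P /\ (forall l, (l < r')%nat -> Derive_n P l tau = Df l tau) /\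
    (forall x, a <= x <= b ->
      Rabs (f x - P x) <= 2 * (C * (b - a) ^ r * omega k (Df r) (b - a) a b)) /\
    (forall x, a <= x <= b -> tau <= x -> 0 <= s * (P x - f x)) /\
    (forall x, a <= x <= b -> x <= tau -> 0 <= (-1) ^ r' * s * (P x - f x)).
Proof.
  intros Hk Hf HC HP a b tau r' s Ha Hab Hb Htau Hr' Hs.
  destruct (HP a b tau Ha Hab Hb Htau) as [P [PP [DP BP]]].
  assert (Hom := omega_nonneg k (Df r) Hk
    (fun x => Cr_derivs_cont_within r f Df Hf r x (Nat.le_refl r)) a b Ha Hab Hb).
  set (om := omega k (Df r) (b - a) a b) in *.
  (* If r' = r - 1, one factor |x - tau| of the remainder is traded for b - a, so that K |x -
     tau|^r' dominates it. Adding this power doubles the error and leaves the derivatives of order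
     below r' at [tau] unchanged. *)
  set (K := C * om * (b - a) ^ (r - r')).
  assert (HK : 0 <= K).
  { apply Rmult_le_pos; [now apply Rmult_le_pos | apply pow_le; lra]. }
  assert (Hs2 : s * s = 1).
  { unfold Rabs in Hs; destruct (Rcase_abs s); nra. }
  assert (Hpow : forall u, (u ^ r)%R = u ^ (r - r') * u ^ r')
    by (intros u; rewrite <- pow_add; f_equal; lia).
  assert (Hx1 : forall x, a <= x <= b -> Rabs (x - tau) <= b - a)
    by (intros x Hx; apply Rabs_le; lra).
  assert (B1 : forall x, a <= x <= b -> Rabs (f x - P x) <= K * Rabs (x - tau) ^ r').
  { intros x Hx; apply Rle_trans with (1 := BP x Hx).
    rewrite Hpow, <- Rmult_assoc; apply Rmult_le_compat_r; [apply pow_le, Rabs_pos|].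
    apply Rmult_le_compat_l; [now apply Rmult_le_pos|].
    apply pow_incr; split; [apply Rabs_pos | now apply Hx1]. }
  assert (B2 : forall x, a <= x <= b -> K * Rabs (x - tau) ^ r' <= C * (b - a) ^ r * om).
  { intros x Hx; rewrite (Hpow (b - a)); unfold K.
    replace (C * ((b - a) ^ (r - r') * (b - a) ^ r') * om)
      with (C * om * (b - a) ^ (r - r') * (b - a) ^ r') by ring.
    apply Rmult_le_compat_l; [exact HK|].
    apply pow_incr; split; [apply Rabs_pos | now apply Hx1]. }
  exists (fun x => P x + s * K * (x - tau) ^ r'); repeat split.
  - apply is_poly_plus; [exact PP|].
    apply is_poly_scal, is_poly_le with (S r'); [lia | apply is_poly_pow].
  - intros l Hl; rewrite (Derive_n_plus_pow (k + r)) by (assumption || lia).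
    rewrite Rminus_diag, (pow_i (r' - l)), DP by lia; ring.
  - intros x Hx.
    replace (f x - (P x + s * K * (x - tau) ^ r'))
      with ((f x - P x) + - (s * (K * (x - tau) ^ r'))) by ring.
    apply Rle_trans with (1 := Rabs_triang _ _).
    rewrite Rabs_Ropp, !Rabs_mult, Hs, <- RPow_abs, (Rabs_pos_eq K) by exact HK.
    specialize (B1 x Hx); specialize (B2 x Hx); lra.
  - intros x Hx Hxt; specialize (B1 x Hx).
    rewrite (Rabs_pos_eq (x - tau)) in B1 by lra.
    replace (s * (P x + s * K * (x - tau) ^ r' - f x))
      with ((s * s) * (K * (x - tau) ^ r') - s * (f x - P x)) by ring.
    rewrite Hs2.
    assert (s * (f x - P x) <= Rabs (f x - P x)).
    { apply Rle_trans with (1 := Rle_abs _); rewrite Rabs_mult, Hs; lra. }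
    lra.
  - intros x Hx Hxt; specialize (B1 x Hx).
    rewrite (Rabs_left1 (x - tau)) in B1 by lra.
    replace (- (x - tau)) with (-1 * (x - tau)) in B1 by ring.
    rewrite Rpow_mult_distr in B1.
    replace ((-1) ^ r' * s * (P x + s * K * (x - tau) ^ r' - f x))
      with ((s * s) * (K * ((-1) ^ r' * (x - tau) ^ r')) - ((-1) ^ r' * s) * (f x - P x)) by ring.
    rewrite Hs2.
    assert ((-1) ^ r' * s * (f x - P x) <= Rabs (f x - P x)).
    { apply Rle_trans with (1 := Rle_abs _); rewrite !Rabs_mult, pow_1_abs, Hs; lra. }
    lra.
Qed.

(** * Knots, breakpoints and signs *)

Lemma fold_Rmax_ge (l : list R) v : In v l -> v <= fold_right Rmax 0 l.
Proof.
  induction l as [|a l IH]; [easy|].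
  intros [->|H]; simpl; [apply Rmax_l|].
  apply Rle_trans with (1 := IH H), Rmax_r.
Qed.

Lemma Jlen_pos z n i : knot_seq z n -> (1 <= i <= Z.of_nat n)%Z -> 0 < Jlen z n i.
Proof.
  intros Hk Hi; unfold Jlen.
  assert (zext z n i < zext z n (i - 1)) by (apply zext_lt; auto; lia); lra.
Qed.

Lemma Jlen_out z n i : knot_seq z n -> ~ (1 <= i <= Z.of_nat n)%Z -> Jlen z n i = 0.
Proof.
  intros Hk Hi; unfold Jlen; destruct (Z_le_gt_dec i 0).
  - rewrite !zext_low by (assumption || lia); ring.
  - rewrite !zext_high by (assumption || lia); ring.
Qed.

Lemma Jlen_neighbour z n i : knot_seq z n -> (1 <= i <= Z.of_nat n)%Z ->
  Jlen z n (i - 1) <= rho z n * Jlen z n i /\ Jlen z n (i + 1) <= rho z n * Jlen z n i.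
Proof.
  intros Hk Hi; assert (HJ := Jlen_pos z n i Hk Hi).
  assert (H : Rmax (Jlen z n (i - 1) / Jlen z n i) (Jlen z n (i + 1) / Jlen z n i)
    <= rho z n).
  { apply fold_Rmax_ge.
    apply in_map_iff; exists (Z.to_nat i); split; [|apply in_seq; lia].
    cbv zeta; rewrite Z2Nat.id by lia; reflexivity. }
  assert (H1 := Rle_trans _ _ _ (Rmax_l _ _) H).
  assert (H2 := Rle_trans _ _ _ (Rmax_r _ _) H).
  split; apply Rmult_le_reg_r with (/ Jlen z n i); try (now apply Rinv_0_lt_compat);
    rewrite (Rmult_assoc (rho z n)), Rinv_r, Rmult_1_r by lra; assumption.
Qed.

(** The sum 1 + 2 (q + ... + q^N): one central interval and N on each side with lengths growing like
    powers of q. *)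
Fixpoint spread (N : nat) (q : R) : R :=
  match N with O => 1 | S N' => spread N' q + 2 * q ^ N end.

Lemma spread_nonneg N q : 0 <= q -> 0 <= spread N q.
Proof.
  intros Hq; induction N as [|N IH]; simpl; [lra|].
  assert (0 <= q * q ^ N) by (apply Rmult_le_pos; [exact Hq | now apply pow_le]); lra.
Qed.

(** Iterating the mesh ratio, the m-th interval on either side has at most q^m times the central
    length; intervals beyond the endpoints have length 0 and obey the same bound. *)
Lemma zext_spread z n i N : knot_seq z n -> (0 <= i < Z.of_nat n)%Z ->
  zext z n (i - Z.of_nat N) - zext z n (i + 1 + Z.of_nat N) <=
  spread N (Rmax 1 (rho z n)) * Jlen z n (i + 1).
Proof.
  intros Hk Hi; set (q := Rmax 1 (rho z n)).
  assert (Hq1 : 1 <= q) by apply Rmax_l; assert (Hq2 : rho z n <= q) by apply Rmax_r.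
  assert (HJ : forall j, 0 <= Jlen z n j).
  { intros j; unfold Jlen; assert (H := zext_antitone z n Hk (j - 1)%Z j ltac:(lia)); lra. }
  assert (Hgeo : forall m, Jlen z n (i + 1 + Z.of_nat m) <= q ^ m * Jlen z n (i + 1) /\
    Jlen z n (i + 1 - Z.of_nat m) <= q ^ m * Jlen z n (i + 1)).
  { induction m as [|m [IH1 IH2]].
    - simpl Z.of_nat; rewrite Z.add_0_r, Z.sub_0_r; simpl; lra.
    - assert (H0 : 0 <= q ^ S m * Jlen z n (i + 1))
        by (apply Rmult_le_pos; [apply pow_le; lra | apply HJ]).
      assert (Hstep : forall a b, b <= rho z n * a -> 0 <= a -> a <= q ^ m * Jlen z n (i + 1) ->
        b <= q ^ S m * Jlen z n (i + 1)).
      { intros a b H1 H2 H3; apply Rle_trans with (1 := H1).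
        apply Rle_trans with (q * a); [now apply Rmult_le_compat_r|].
        simpl; rewrite Rmult_assoc; apply Rmult_le_compat_l; lra. }
      split.
      + destruct (Z_le_gt_dec (i + 1 + Z.of_nat (S m)) (Z.of_nat n)) as [Hc|Hc];
          [|rewrite (Jlen_out z n (i + 1 + Z.of_nat (S m)) Hk) by lia; exact H0].
        apply (Hstep (Jlen z n (i + 1 + Z.of_nat m))); auto.
        replace (i + 1 + Z.of_nat (S m))%Z with (i + 1 + Z.of_nat m + 1)%Z by lia.
        apply Jlen_neighbour; [exact Hk | lia].
      + destruct (Z_le_gt_dec 1 (i + 1 - Z.of_nat (S m))) as [Hc|Hc];
          [|rewrite (Jlen_out z n (i + 1 - Z.of_nat (S m)) Hk) by lia; exact H0].
        apply (Hstep (Jlen z n (i + 1 - Z.of_nat m))); auto.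
        replace (i + 1 - Z.of_nat (S m))%Z with (i + 1 - Z.of_nat m - 1)%Z by lia.
        apply Jlen_neighbour; [exact Hk | lia]. }
  induction N as [|N IH].
  - simpl Z.of_nat; rewrite Z.add_0_r, Z.sub_0_r; simpl; unfold Jlen.
    replace (i + 1 - 1)%Z with i by lia; lra.
  - destruct (Hgeo (S N)) as [G1 G2].
    change (spread (S N) q) with (spread N q + 2 * q ^ S N).
    unfold Jlen in G1 at 1; unfold Jlen in G2 at 1.
    replace (i + 1 + Z.of_nat (S N) - 1)%Z with (i + 1 + Z.of_nat N)%Z in G1 by lia.
    replace (i + 1 - Z.of_nat (S N) - 1)%Z with (i - Z.of_nat (S N))%Z in G2 by lia.
    replace (i + 1 - Z.of_nat (S N))%Z with (i - Z.of_nat N)%Z in G2 by lia.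
    lra.
Qed.

(** * Breakpoints and their separation by knots *)

Lemma exists_next (l : list R) x y : x < y ->
  exists b, (b = y \/ In b l) /\ x < b <= y /\ forall v, In v l -> ~ (x < v < b).
Proof.
  intros Hxy; induction l as [|a l [b [Hb [Hxb Hn]]]].
  - exists y; repeat split; auto; lra.
  - destruct (Rlt_dec x a) as [Ha|Ha]; [destruct (Rlt_dec a b) as [Hab|Hab]|].
    + exists a; split; [right; now left|]; split; [lra|].
      intros v [->|Hv]; [lra|]; specialize (Hn v Hv); lra.
    + exists b; split; [destruct Hb; auto; right; now right|]; split; [exact Hxb|].
      intros v [->|Hv]; [lra|]; auto.
    + exists b; split; [destruct Hb; auto; right; now right|]; split; [exact Hxb|].
      intros v [->|Hv]; [lra|]; auto.
Qed.

Lemma exists_argmin (F : Z -> R) lo (m : nat) :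
  exists j, (lo <= j <= lo + Z.of_nat m)%Z /\
    forall j', (lo <= j' <= lo + Z.of_nat m)%Z -> F j <= F j'.
Proof.
  induction m as [|m [j [Hj IH]]].
  - exists lo; split; [lia|]; intros j' Hj'; replace j' with lo by lia; lra.
  - destruct (Rle_dec (F j) (F (lo + Z.of_nat (S m))%Z)) as [H|H].
    + exists j; split; [lia|]; intros j' Hj'.
      destruct (Z.eq_dec j' (lo + Z.of_nat (S m))) as [->|]; [exact H | apply IH; lia].
    + exists (lo + Z.of_nat (S m))%Z; split; [lia|]; intros j' Hj'.
      destruct (Z.eq_dec j' (lo + Z.of_nat (S m))) as [->|]; [lra|].
      specialize (IH j' ltac:(lia)); lra.
Qed.

Definition breakpoint (y : nat -> R) (s : nat) (alpha : nat -> R) (p : nat) (v : R) : Prop :=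
  v = 1 \/ v = -1 \/
  (exists i : nat, (1 <= i <= s)%nat /\ v = y i) \/
  (exists i : nat, (1 <= i <= p)%nat /\ v = alpha i).

Lemma breakpoint_next y s alpha p v w : breakpoint y s alpha p w -> v < w ->
  exists b, breakpoint y s alpha p b /\ v < b <= w /\
    forall u, breakpoint y s alpha p u -> ~ (v < u < b).
Proof.
  intros Hw Hvw.
  set (l := 1 :: -1 :: map y (seq 1 s) ++ map alpha (seq 1 p)).
  assert (Hl : forall u, breakpoint y s alpha p u <-> In u l).
  { intros u; unfold l; simpl; rewrite in_app_iff, !in_map_iff; split.
    - intros [->|[->|[[i [Hi ->]]|[i [Hi ->]]]]]; auto; right; right; [left|right];
        exists i; (split; [reflexivity | apply in_seq; lia]).
    - intros [<-|[<-|[[i [<- Hi]]|[i [<- Hi]]]]]; apply in_seq in Hi || idtac;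
        [now left | right; now left | right; right; left | right; right; right];
        exists i; (split; [lia | reflexivity]). }
  destruct (exists_next l v w Hvw) as [b [Hb [Hvb Hn]]].
  exists b; split; [|split; [exact Hvb | intros u Hu; apply Hn, Hl, Hu]].
  destruct Hb as [->|Hb]; [exact Hw | now apply Hl].
Qed.

(* The closed support of the j-th B-spline contains [v]. *)
Definition touches (t : Z -> R) (e : nat) (j : Z) (v : R) : Prop :=
  t (j + Z.of_nat e + 1)%Z <= v <= t j.

(** If v' < v, a knot strictly between them has an index above j and below j' + e + 1, which leaves
    at most 2e indices, fewer than 4 e^2. The knot condition concerns consecutive breakpoints, so it
    is applied to v' and the next breakpoint above it. *)
Lemma touches_separated z n e y s alpha p : knot_seq z n -> (1 <= e)%nat ->
  (forall a b : R, breakpoint y s alpha p a -> breakpoint y s alpha p b -> a < b ->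
     (forall v, breakpoint y s alpha p v -> ~ (a < v < b)) ->
     (4 * e ^ 2 <= knots_in z n a b)%nat) ->
  forall j j' v v', breakpoint y s alpha p v -> breakpoint y s alpha p v' ->
    touches (zext z n) e j v -> touches (zext z n) e j' v' ->
    (Z.abs (j - j') <= Z.of_nat e)%Z -> v = v'.
Proof.
  intros Hk He Hknots.
  assert (Hlt : forall j j' v v', breakpoint y s alpha p v -> breakpoint y s alpha p v' ->
    touches (zext z n) e j v -> touches (zext z n) e j' v' ->
    (Z.abs (j - j') <= Z.of_nat e)%Z -> ~ v' < v).
  { intros j j' v v' Hv Hv' [_ Hj] [Hj' _] Hjj Hlt.
    destruct (breakpoint_next y s alpha p v' v Hv Hlt) as [b [Hb [Hvb Hn]]].
    assert (H := Hknots v' b Hv' Hb ltac:(lra) Hn); unfold knots_in in H.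
    set (P := fun j => _) in H.
    assert (Hlen : (length (filter P (seq 0 (S n))) <=
      length (seq (Z.to_nat (j + 1)) (2 * e)))%nat).
    { apply NoDup_incl_length; [apply NoDup_filter, seq_NoDup|].
      intros i Hi; apply filter_In in Hi; destruct Hi as [Hi1 Hi2]; apply in_seq in Hi1.
      unfold P in Hi2; destruct (Rlt_dec v' (z i)) as [H1|]; [|easy].
      destruct (Rlt_dec (z i) b) as [H2|]; [|easy].
      rewrite <- (zext_nat z n i) in H1, H2 by lia.
      assert (Hij : (j < Z.of_nat i)%Z).
      { apply Z.nle_gt; intros Hc; assert (Ha := zext_antitone z n Hk _ _ Hc); lra. }
      assert (Hij' : (Z.of_nat i < j' + Z.of_nat e + 1)%Z).
      { apply Z.nle_gt; intros Hc; assert (Ha := zext_antitone z n Hk _ _ Hc); lra. }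
      apply in_seq; lia. }
    rewrite length_seq in Hlen.
    assert (e * 1 <= e * e)%nat by (apply Nat.mul_le_mono_l; lia).
    rewrite Nat.pow_2_r in H; lia. }
  intros j j' v v' Hv Hv' Hj Hj' Hjj.
  destruct (Rtotal_order v v') as [H|[H|H]]; [|exact H|]; exfalso.
  - apply (Hlt j' j v' v); auto; lia.
  - apply (Hlt j j' v v'); auto.
Qed.

(** The slack of one on both sides is due to [v] being possibly a knot: then supports that merely
    end at [v] touch it too. *)
Lemma touches_range z n e j v (i : nat) : knot_seq z n -> (i < n)%nat ->
  (- Z.of_nat e <= j < Z.of_nat n)%Z -> touches (zext z n) e j v ->
  zext z n (Z.of_nat i + 1) <= v <= zext z n (Z.of_nat i) ->
  (j <= Z.of_nat i + 1)%Z /\ (Z.of_nat i <= j + Z.of_nat e + 1)%Z.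
Proof.
  intros Hk Hi Hj [H1 H2] Hv; split; apply Z.nlt_ge; intros Hc.
  - assert (zext z n j < zext z n (Z.of_nat i + 1)) by (apply zext_lt; auto; lia); lra.
  - assert (zext z n (Z.of_nat i) < zext z n (j + Z.of_nat e + 1))
      by (apply zext_lt; auto; lia); lra.
Qed.

(** A relation and not a function of [x]: at a point of Y both signs are required. *)
Definition required_sign (y : nat -> R) (s : nat) (sigma x : R) : Prop :=
  exists i : nat, (i <= s)%nat /\ yext y s (S i) <= x <= yext y s i /\ sigma = (-1) ^ i.

Lemma required_sign_abs y s sigma x : required_sign y s sigma x -> Rabs sigma = 1.
Proof. intros [i [_ [_ ->]]]; apply pow_1_abs. Qed.

Lemma yext_y y s q : (1 <= q <= s)%nat -> yext y s q = y q.
Proof.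
  intros Hq; unfold yext.
  destruct (Nat.eqb_spec q 0); [lia|]; destruct (Nat.eqb_spec q (S s)); [lia | reflexivity].
Qed.

Lemma yext_S y s (Hy : forall i : nat, (1 <= i <= s)%nat -> -1 < y i < 1)
  (Hys : forall i : nat, (1 <= i < s)%nat -> y (S i) < y i) i :
  (i <= s)%nat -> yext y s (S i) < yext y s i.
Proof.
  intros Hi; unfold yext; simpl Nat.eqb at 1.
  destruct (Nat.eqb_spec (S i) (S s)) as [H|H], (Nat.eqb_spec i 0) as [H'|H'];
    try destruct (Nat.eqb_spec i (S s)) as [H''|H'']; try lia; try lra.
  - apply Hy; lia.
  - apply Hy; lia.
  - apply Hys; lia.
Qed.

Lemma yext_lt y s (Hy : forall i : nat, (1 <= i <= s)%nat -> -1 < y i < 1)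
  (Hys : forall i : nat, (1 <= i < s)%nat -> y (S i) < y i) i j :
  (i < j <= S s)%nat -> yext y s j < yext y s i.
Proof.
  induction j as [|j IH]; intros H; [lia|].
  assert (H1 := yext_S y s Hy Hys j ltac:(lia)).
  destruct (Nat.eq_dec i j) as [->|]; [exact H1|].
  apply Rlt_trans with (1 := H1), IH; lia.
Qed.

Lemma yext_le y s (Hy : forall i : nat, (1 <= i <= s)%nat -> -1 < y i < 1)
  (Hys : forall i : nat, (1 <= i < s)%nat -> y (S i) < y i) i j :
  (i <= j <= S s)%nat -> yext y s j <= yext y s i.
Proof.
  intros H; destruct (Nat.eq_dec i j) as [->|]; [lra | left; apply yext_lt; auto; lia].
Qed.

Lemma required_sign_exists y s x : -1 <= x <= 1 -> exists sigma, required_sign y s sigma x.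
Proof.
  intros Hx.
  assert (H : forall m, (m <= s)%nat -> yext y s (S m) <= x ->
    exists sigma, required_sign y s sigma x).
  { induction m as [|m IH]; intros Hm H1.
    - exists ((-1) ^ 0), 0%nat; repeat split; [lia | exact H1 |].
      unfold yext; simpl; lra.
    - destruct (Rle_dec x (yext y s (S m))) as [H2|H2]; [|apply IH; [lia | lra]].
      exists ((-1) ^ S m), (S m); repeat split; [lia | exact H1 | exact H2]. }
  apply (H s); [lia|].
  unfold yext; simpl; rewrite Nat.eqb_refl; lra.
Qed.

Lemma required_sign_const y s (Hy : forall i : nat, (1 <= i <= s)%nat -> -1 < y i < 1)
  (Hys : forall i : nat, (1 <= i < s)%nat -> y (S i) < y i) sigma sigma' x x' :
  required_sign y s sigma x -> required_sign y s sigma' x' ->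
  (forall q, (1 <= q <= s)%nat -> ~ (Rmin x x' <= y q <= Rmax x x')) -> sigma = sigma'.
Proof.
  intros [i [Hi [Hx ->]]] [i' [Hi' [Hx' ->]]] Hn.
  destruct (Nat.lt_trichotomy i i') as [H|[->|H]]; [|reflexivity|]; exfalso.
  - assert (H1 := yext_le y s Hy Hys (S i) i' ltac:(lia)).
    apply (Hn i'); [lia|]; rewrite <- (yext_y y s i') by lia.
    rewrite Rmin_right, Rmax_left by lra; lra.
  - assert (H1 := yext_le y s Hy Hys (S i') i ltac:(lia)).
    apply (Hn i); [lia|]; rewrite <- (yext_y y s i) by lia.
    rewrite Rmin_left, Rmax_right by lra; lra.
Qed.

Lemma required_sign_at_zero y s (Hy : forall i : nat, (1 <= i <= s)%nat -> -1 < y i < 1)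
  (Hys : forall i : nat, (1 <= i < s)%nat -> y (S i) < y i) sigma q x :
  (1 <= q <= s)%nat -> required_sign y s sigma x ->
  (forall q', (1 <= q' <= s)%nat -> q' <> q -> ~ (Rmin (y q) x <= y q' <= Rmax (y q) x)) ->
  (y q <= x /\ sigma = (-1) ^ (q - 1)) \/ (x <= y q /\ sigma = (-1) ^ q).
Proof.
  intros Hq [i [Hi [Hx ->]]] Hn.
  destruct (Nat.eq_dec i q) as [->|H1].
  { right; rewrite (yext_y y s q) in Hx by lia; split; [lra | reflexivity]. }
  destruct (Nat.eq_dec (S i) q) as [<-|H2].
  { left; rewrite (yext_y y s (S i)) in Hx by lia; split; [lra|]; f_equal; lia. }
  exfalso; destruct (Nat.lt_ge_cases q i) as [H|H].
  - assert (H3 := yext_lt y s Hy Hys q i ltac:(lia)); rewrite !yext_y in H3 by lia.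
    rewrite (yext_y y s i) in Hx by lia.
    apply (Hn i); [lia | lia |]; rewrite Rmin_right, Rmax_left by lra; lra.
  - assert (H3 := yext_lt y s Hy Hys (S i) q ltac:(lia)); rewrite !yext_y in H3 by lia.
    rewrite (yext_y y s (S i)) in Hx by lia.
    apply (Hn (S i)); [lia | lia |]; rewrite Rmin_left, Rmax_right by lra; lra.
Qed.

(** Fixes, for each breakpoint, the exponent and the sign to be given to [one_sided_hermite]. An odd
    exponent follows the sign change at a point of Y, an even one the constant sign at a point of A.
    An endpoint takes r whatever its parity, even if it also belongs to A, which is enough since r1
    <= r. *)
Lemma breakpoint_role y s alpha p r r1 r2 :
  (forall i : nat, (1 <= i <= s)%nat -> -1 < y i < 1) ->
  (forall i : nat, (1 <= i < s)%nat -> y (S i) < y i) ->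
  (forall i : nat, (1 <= i <= p)%nat -> -1 <= alpha i <= 1) ->
  (forall i j : nat, (1 <= i <= s)%nat -> (1 <= j <= p)%nat -> y i <> alpha j) ->
  (r1 = r \/ S r1 = r) -> (r2 = r \/ S r2 = r) -> (-1) ^ r1 = 1 -> (-1) ^ r2 = -1 ->
  forall v, breakpoint y s alpha p v -> exists r' sigma,
    (r' = r \/ S r' = r) /\ Rabs sigma = 1 /\
    (forall j, (1 <= j <= p)%nat -> v = alpha j -> (r1 <= r')%nat) /\
    (forall j, (1 <= j <= s)%nat -> v = y j -> (r2 <= r')%nat) /\
    (v = 1 \/ v = -1 -> r' = r) /\
    forall x sigma', -1 <= x <= 1 -> required_sign y s sigma' x ->
      (forall w, breakpoint y s alpha p w -> w <> v -> ~ (Rmin v x <= w <= Rmax v x)) ->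
      (v <= x /\ sigma' = sigma) \/ (x <= v /\ sigma' = (-1) ^ r' * sigma).
Proof.
  intros Hy Hys Ha Hya Hr1 Hr2 E1 E2 v Hv.
  assert (Hvb : -1 <= v <= 1).
  { destruct Hv as [->|[->|[[i [Hi ->]]|[i [Hi ->]]]]]; try lra; [|now apply Ha].
    specialize (Hy i Hi); lra. }
  assert (Hbp : forall q, (1 <= q <= s)%nat -> breakpoint y s alpha p (y q))
    by (intros q Hq; right; right; left; now exists q).
  destruct (required_sign_exists y s v Hvb) as [s0 Hs0].
  assert (Hs0a := required_sign_abs _ _ _ _ Hs0).
  assert (Hsq : (-1) ^ r * (-1) ^ r = 1)
    by (rewrite <- Rpow_mult_distr; replace (-1 * -1) with 1 by ring; apply pow1).
  assert (Hconst : (forall q, (1 <= q <= s)%nat -> y q <> v) ->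
    forall x sigma', required_sign y s sigma' x ->
    (forall w, breakpoint y s alpha p w -> w <> v -> ~ (Rmin v x <= w <= Rmax v x)) ->
    sigma' = s0).
  { intros Hne x sigma' Hs' Hw; symmetry.
    apply (required_sign_const y s Hy Hys s0 sigma' v x Hs0 Hs').
    intros q Hq; apply Hw; [apply Hbp, Hq | apply Hne, Hq]. }
  destruct (Req_dec v 1) as [H1|H1]; [|destruct (Req_dec v (-1)) as [H2|H2]].
  - subst v.
    (* Only points to the left of 1 occur, and there the sign is multiplied by (-1)^r; the factor
       put in here compensates it. *)
    exists r, ((-1) ^ r * s0); repeat split; auto; try lia.
    + rewrite Rabs_mult, pow_1_abs, Hs0a; ring.
    + intros x sigma' Hx Hs' Hw; right; split; [lra|].
      rewrite <- Rmult_assoc, Hsq, Rmult_1_l; apply (Hconst) with x; auto.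
      intros q Hq; specialize (Hy q Hq); lra.
  - subst v.
    exists r, s0; repeat split; auto; try lia.
    intros x sigma' Hx Hs' Hw; left; split; [lra|].
    apply (Hconst) with x; auto.
    intros q Hq; specialize (Hy q Hq); lra.
  - destruct Hv as [Hv|[Hv|[[q [Hq ->]]|[q [Hq ->]]]]]; [easy | easy | |].
    (* The sign on the right of [y q] is (-1)^(q-1); as [r2] is odd, the left side receives
       (-1)^q. *)
    + exists r2, ((-1) ^ (q - 1)); repeat split; auto.
      * apply pow_1_abs.
      * intros j Hj Hej; exfalso; now apply (Hya q j).
      * tauto.
      * intros x sigma' Hx Hs' Hw; rewrite E2.
        replace (-1 * (-1) ^ (q - 1)) with ((-1) ^ q)
          by (replace q with (S (q - 1)) at 1 by lia; reflexivity).
        apply (required_sign_at_zero y s Hy Hys); auto.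
        intros q' Hq' Hne; apply Hw; [apply Hbp, Hq'|].
        destruct (Nat.lt_ge_cases q q') as [Hlt|Hge].
        -- assert (H := yext_lt y s Hy Hys q q' ltac:(lia)); rewrite !yext_y in H by lia; lra.
        -- assert (H := yext_lt y s Hy Hys q' q ltac:(lia)); rewrite !yext_y in H by lia; lra.
    + exists r1, s0; repeat split; auto.
      * intros j Hj Hej; exfalso; apply (Hya j q Hj Hq); now symmetry.
      * tauto.
      * intros x sigma' Hx Hs' Hw; rewrite E1, Rmult_1_l.
        assert (sigma' = s0).
        { apply (Hconst) with x; auto; intros q' Hq'; now apply Hya. }
        destruct (Rle_dec (alpha q) x); [left | right]; split; auto; lra.
Qed.

(** * The spline *)

Lemma db_ge_reference t e c q i x m sigma : is_poly (S e) q -> antitone t ->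
  t (i + 1)%Z < t i -> t (i + 1)%Z <= x <= t i ->
  (forall j, (i - Z.of_nat e <= j <= i)%Z -> m <= sigma * (c j - coef t e q j)) ->
  m <= sigma * (db t e c e i x - q x).
Proof.
  intros Hq Ht Hi Hx H.
  replace (sigma * (db t e c e i x - q x)) with
    (db t e (fun j => sigma * c j + (- sigma) * coef t e q j) e i x)
    by (rewrite db_lin, db_reproduces by assumption; ring).
  apply db_ge; auto; intros j Hj; specialize (H j Hj); lra.
Qed.

Lemma db_near_reference t e c q i x m : is_poly (S e) q -> antitone t ->
  t (i + 1)%Z < t i -> t (i + 1)%Z <= x <= t i ->
  (forall j, (i - Z.of_nat e <= j <= i)%Z -> Rabs (c j - coef t e q j) <= m) ->
  Rabs (db t e c e i x - q x) <= m.
Proof.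
  intros Hq Ht Hi Hx H.
  replace (db t e c e i x - q x) with
    (db t e (fun j => 1 * c j + (-1) * coef t e q j) e i x)
    by (rewrite db_lin, db_reproduces by assumption; ring).
  apply db_abs_le; auto; intros j Hj; specialize (H j Hj).
  replace (1 * c j + -1 * coef t e q j) with (c j - coef t e q j) by ring; exact H.
Qed.

(** The coefficients of [W] and [q] may differ by 3 Cl M in the wrong direction. The shift (3 Cl +
    1) M absorbs this and leaves a surplus M; in absolute value the two add up to (6 Cl + 1) M. *)
Lemma coef_raised t e W q j sigma M Cl : is_poly (S e) W -> is_poly (S e) q ->
  Rabs sigma = 1 -> 0 <= M -> 0 <= Cl ->
  Rabs (coef t e (fun x => 1 * W x + (-1) * q x) j) <= Cl * (3 * M) ->
  let c := coef t e (fun x => 1 * W x + (sigma * ((3 * Cl + 1) * M)) * 1) j in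
  M <= sigma * (c - coef t e q j) /\ Rabs (c - coef t e q j) <= (6 * Cl + 1) * M.
Proof.
  intros HW Hq Hs HM HCl HB c.
  rewrite coef_lin in HB by assumption.
  unfold c; rewrite (coef_lin t e 1 W _ (fun _ => 1)), coef_const
    by (assumption || apply is_poly_const).
  assert (Hs2 : sigma * sigma = 1).
  { unfold Rabs in Hs; destruct (Rcase_abs sigma); nra. }
  set (D := 1 * coef t e W j + -1 * coef t e q j) in *.
  replace (1 * coef t e W j + sigma * ((3 * Cl + 1) * M) * 1 - coef t e q j)
    with (D + sigma * ((3 * Cl + 1) * M)) by (unfold D; ring).
  assert (HK : 0 <= (3 * Cl + 1) * M) by (apply Rmult_le_pos; lra).
  split.
  - replace (sigma * (D + sigma * ((3 * Cl + 1) * M)))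
      with (sigma * D + (sigma * sigma) * ((3 * Cl + 1) * M)) by ring.
    rewrite Hs2.
    assert (H : Rabs (sigma * D) <= Cl * (3 * M)) by (rewrite Rabs_mult, Hs; lra).
    apply Rabs_le_between in H; lra.
  - apply Rle_trans with (1 := Rabs_triang _ _).
    rewrite (Rabs_mult sigma), Hs, (Rabs_pos_eq ((3 * Cl + 1) * M)) by exact HK; lra.
Qed.

(** [r1] and [r2] count the matched derivatives at A and at Y, and only their parities matter for
    the signs. The mesh ratio is fixed before the constant, which may thus depend on it but not on
    the knots or on [f]. *)
Lemma intertwining_spline k r r1 r2 rho0 :
  (1 <= k)%nat -> (1 <= r)%nat -> (r1 = r \/ S r1 = r) -> (r2 = r \/ S r2 = r) ->
  (-1) ^ r1 = 1 -> (-1) ^ r2 = -1 ->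
  exists C, forall (s p : nat) (y alpha : nat -> R) (f : R -> R) (Df : nat -> R -> R)
    (n : nat) (z : nat -> R),
  (forall i : nat, (1 <= i <= s)%nat -> -1 < y i < 1) ->
  (forall i : nat, (1 <= i < s)%nat -> y (S i) < y i) ->
  (forall i : nat, (1 <= i <= p)%nat -> -1 <= alpha i <= 1) ->
  (forall i j : nat, (1 <= i <= s)%nat -> (1 <= j <= p)%nat -> y i <> alpha j) ->
  Cr_derivs (-1) 1 r f Df -> knot_seq z n -> rho z n = rho0 ->
  (forall a b : R, breakpoint y s alpha p a -> breakpoint y s alpha p b -> a < b ->
     (forall v, breakpoint y s alpha p v -> ~ (a < v < b)) ->
     (4 * (k + r - 1) ^ 2 <= knots_in z n a b)%nat) ->
  exists (S : R -> R) (DS : nat -> R -> R),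
    Sigma (k + r) z n S /\ Cr_derivs (-1) 1 (k + r - 2) S DS /\
    Delta0 y s (fun x => S x - f x) /\
    (forall j i : nat, (1 <= j <= p)%nat -> (i < r1)%nat -> DS i (alpha j) = Df i (alpha j)) /\
    (forall j i : nat, (1 <= j <= s)%nat -> (i < r2)%nat -> DS i (y j) = Df i (y j)) /\
    (forall i : nat, (i < r)%nat -> DS i 1 = Df i 1 /\ DS i (-1) = Df i (-1)) /\
    (forall (i : nat) x, (i < n)%nat ->
      zext z n (Z.of_nat i + 1) <= x <= zext z n (Z.of_nat i) ->
      let L := Z.of_nat (6 * (k + r - 1) ^ 2) in
      let a := zext z n (Z.of_nat i + 1 + L) in
      let b := zext z n (Z.of_nat i + 1 - L) in
      Rabs (f x - S x) <= C * Jlen z n (Z.of_nat i + 1) ^ r * omega k (Df r) (b - a) a b).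
Proof.
  intros Hk Hr Hr1 Hr2 E1 E2.
  destruct (hermite_whitney k r Hk) as [C0 [HC0 HH]].
  set (e := (k + r - 1)%nat); set (rr := Rmax 1 rho0).
  assert (He : (1 <= e)%nat) by (unfold e; lia).
  assert (Eke : (k + r = S e)%nat) by (unfold e; lia).
  assert (Hrr : 1 <= rr) by apply Rmax_l.
  destruct (coef_bound e (spread e rr)) as [Cl [HCl HCB]]; [apply spread_nonneg; lra|].
  set (L := (6 * e ^ 2)%nat).
  assert (HL : (6 * e <= L)%nat).
  { unfold L; rewrite Nat.pow_2_r; apply Nat.mul_le_mono_l.
    rewrite <- (Nat.mul_1_r e) at 1; apply Nat.mul_le_mono_l; lia. }
  (* 6 Cl + 1 bounds the distance from the spline to the reference polynomial and 2 that from the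
     reference to [f], in units of the window error; [C0] is the Whitney constant, and the power of
     [spread] replaces the window length by that of the knot interval. *)
  exists ((6 * Cl + 3) * C0 * spread L rr ^ r).
  intros s p y alpha f Df n z Hy Hys Ha Hya Hf Hz Hrho Hknots.
  set (t := zext z n).
  assert (Hn := knot_seq_pos z n Hz).
  assert (Ht : antitone t) by (now apply zext_antitone).
  assert (Htb : forall i, -1 <= t i <= 1) by (intros; now apply zext_bounds).
  assert (Htlt : forall a b, (a < b)%Z -> (a < Z.of_nat n)%Z -> (0 < b)%Z -> t b < t a)
    by (intros; now apply zext_lt).
  set (B := breakpoint y s alpha p).
  assert (Hsep := touches_separated z n e y s alpha p Hz He Hknots); fold t in Hsep; fold B in Hsep.
  set (Mw := fun a b => C0 * (b - a) ^ r * omega k (Df r) (b - a) a b).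
  assert (Hcw : forall x, -1 <= x <= 1 -> cont_within (-1) 1 (Df r) x)
    by (intros; now apply (Cr_derivs_cont_within r f Df Hf)).
  assert (HMw0 : forall a b, -1 <= a -> a < b -> b <= 1 -> 0 <= Mw a b).
  { intros a b H1 H2 H3; apply Rmult_le_pos; [|now apply omega_nonneg].
    apply Rmult_le_pos; [exact HC0 | apply pow_le; lra]. }
  assert (HMw : forall a b a' b', -1 <= a' -> a' <= a -> a < b -> b <= b' -> b' <= 1 ->
    Mw a b <= Mw a' b').
  { intros a b a' b' H1 H2 H3 H4 H5; unfold Mw.
    apply Rmult_le_compat.
    - apply Rmult_le_pos; [exact HC0 | apply pow_le; lra].
    - apply omega_nonneg; auto; lra.
    - apply Rmult_le_compat_l; [exact HC0|]; apply pow_incr; lra.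
    - now apply omega_mono. }
  (* By [touches_range] a B-spline touching [v] has index from iv - e - 1 to iv + 1, so its support
     lies between the knots of index iv + e + 2 and iv - e - 1. This is the window of [v]. *)
  assert (HPB : forall v, exists P, B v -> exists iv : nat, (iv < n)%nat /\
    t (Z.of_nat iv + 1)%Z <= v <= t (Z.of_nat iv) /\ is_poly (S e) P /\
    (forall x, t (Z.of_nat iv + Z.of_nat e + 2)%Z <= x <= t (Z.of_nat iv - Z.of_nat e - 1)%Z ->
      Rabs (f x - P x) <=
        2 * Mw (t (Z.of_nat iv + Z.of_nat e + 2)%Z) (t (Z.of_nat iv - Z.of_nat e - 1)%Z)) /\
    (forall x sigma, t (Z.of_nat iv + Z.of_nat e + 2)%Z <= x ->
      x <= t (Z.of_nat iv - Z.of_nat e - 1)%Z -> required_sign y s sigma x ->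
      (forall w, B w -> w <> v -> ~ (Rmin v x <= w <= Rmax v x)) -> 0 <= sigma * (P x - f x)) /\
    (forall j l, (1 <= j <= p)%nat -> v = alpha j -> (l < r1)%nat -> Derive_n P l v = Df l v) /\
    (forall j l, (1 <= j <= s)%nat -> v = y j -> (l < r2)%nat -> Derive_n P l v = Df l v) /\
    (forall l, (v = 1 \/ v = -1) -> (l < r)%nat -> Derive_n P l v = Df l v)).
  { intros v; destruct (classic (B v)) as [Hv|Hv]; [|exists (fun _ => 0); tauto].
    destruct (breakpoint_role y s alpha p r r1 r2 Hy Hys Ha Hya Hr1 Hr2 E1 E2 v Hv)
      as [r' [sg [Hr' [Hsg [Ra [Ry [R1 Hrole]]]]]]].
    assert (Hvb : -1 <= v <= 1).
    { destruct Hv as [->|[->|[[i [Hi ->]]|[i [Hi ->]]]]]; try lra; [|now apply Ha].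
      specialize (Hy i Hi); lra. }
    destruct (zext_locate z n v Hz Hvb) as [iv [Hiv Hivt]]; fold t in Hivt.
    set (a := t (Z.of_nat iv + Z.of_nat e + 2)%Z).
    set (b := t (Z.of_nat iv - Z.of_nat e - 1)%Z).
    assert (Hab : a < b) by (apply Htlt; lia).
    assert (H1 : a <= t (Z.of_nat iv + 1)%Z) by (apply Ht; lia).
    assert (H2 : t (Z.of_nat iv) <= b) by (apply Ht; lia).
    assert (Hba := Htb (Z.of_nat iv + Z.of_nat e + 2)%Z); fold a in Hba.
    assert (Hbb := Htb (Z.of_nat iv - Z.of_nat e - 1)%Z); fold b in Hbb.
    destruct (one_sided_hermite k r f Df C0 Hk Hf HC0
      (fun a b tau => HH f Df a b tau Hf) a b v r' sg)
      as [P [PP [DP [BP [SR SL]]]]]; try lra; auto.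
    exists P; intros _; exists iv; split; [exact Hiv|]; split; [exact Hivt|].
    split; [now rewrite <- Eke|]; split; [exact BP|]; split.
    { intros x sigma Hx1 Hx2 Hreq Hw; change (a <= x) in Hx1; change (x <= b) in Hx2.
      destruct (Hrole x sigma ltac:(lra) Hreq Hw) as [[Hc ->]|[Hc ->]].
      - apply SR; lra.
      - apply SL; lra. }
    repeat split.
    - intros j l Hj Ej Hl; apply DP; specialize (Ra j Hj Ej); lia.
    - intros j l Hj Ej Hl; apply DP; specialize (Ry j Hj Ej); lia.
    - intros l Ej Hl; apply DP; rewrite (R1 Ej); exact Hl. }
  apply choice in HPB; destruct HPB as [PB HPB].
  (* These windows are wide enough to contain the window of every breakpoint touched by a B-spline
     of index j0 with |j - j0| <= e: iv + e + 2 <= j0 + 2e + 3 <= j + 3e + 3 and iv - e - 1 >= j0 -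
     e - 2 >= j - 2e - 2. Hence the error bound at the breakpoint is at most [M j]. *)
  set (wlo := fun j => t (j + 3 * Z.of_nat e + 3)%Z).
  set (whi := fun j => t (j - 2 * Z.of_nat e - 2)%Z).
  set (M := fun j => Mw (wlo j) (whi j)).
  set (K := 3 * Cl + 1).
  set (active := fun j => (- Z.of_nat e <= j < Z.of_nat n)%Z).
  assert (Hwin : forall j, active j -> -1 <= wlo j /\ wlo j < whi j /\ whi j <= 1).
  { intros j Hj; unfold active in Hj; split; [apply Htb|]; split; [apply Htlt; lia | apply Htb]. }
  assert (HM0 : forall j, active j -> 0 <= M j)
    by (intros j Hj; destruct (Hwin j Hj) as [H1 [H2 H3]]; now apply HMw0).
  assert (Hq : forall j, exists q, active j ->
    (exists v, B v /\ touches t e j v /\ q = PB v) \/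
    ((forall v, B v -> ~ touches t e j v) /\ exists W sg, Rabs sg = 1 /\ is_poly (S e) W /\
      (forall x, wlo j <= x <= whi j -> Rabs (f x - W x) <= M j) /\
      (forall x sigma, t (j + Z.of_nat e + 1)%Z <= x <= t j -> required_sign y s sigma x ->
        sigma = sg) /\
      q = (fun x => 1 * W x + (sg * (K * M j)) * 1))).
  { intros j; destruct (classic (active j)) as [Hj|Hj]; [|exists (fun _ => 0); tauto].
    destruct (classic (exists v, B v /\ touches t e j v)) as [[v [Hv Hjv]]|Hno].
    { exists (PB v); intros _; left; now exists v. }
    destruct (Hwin j Hj) as [H1 [H2 H3]].
    (* No interpolation is wanted here; the base point [wlo j] is an arbitrary choice. *)
    destruct (HH f Df (wlo j) (whi j) (wlo j) Hf H1 H2 H3 ltac:(lra)) as [W [PW [_ BW]]].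
    destruct (required_sign_exists y s (t j) (Htb j)) as [sg Hsg].
    exists (fun x => 1 * W x + (sg * (K * M j)) * 1); intros _; right; split.
    { intros v Hv Hjv; apply Hno; now exists v. }
    exists W, sg; split; [now apply required_sign_abs in Hsg|].
    split; [now rewrite <- Eke|]; split; [|split; [|reflexivity]].
    - intros x Hx; apply Rle_trans with (1 := BW x Hx).
      unfold M, Mw; rewrite Rmult_assoc, (Rmult_comm (omega _ _ _ _ _)), <- Rmult_assoc.
      apply Rmult_le_compat_r; [now apply omega_nonneg|].
      apply Rmult_le_compat_l; [exact HC0|].
      apply pow_incr; split; [apply Rabs_pos | apply Rabs_le; lra].
    (* The support contains no point of Y, so one sign is required on all of it. *)
    - intros x sigma Hx Hs; apply (required_sign_const y s Hy Hys sigma sg x (t j) Hs Hsg).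
      intros q Hq1 Hq2; apply Hno; exists (y q); split.
      + right; right; left; now exists q.
      + rewrite Rmin_left, Rmax_right in Hq2 by lra; unfold touches; lra. }
  apply choice in Hq; destruct Hq as [q Hq].
  set (c := fun j => coef t e (q j) j).
  set (Mh := fun i : nat => Mw (t (Z.of_nat i + 1 + Z.of_nat L)%Z)
    (t (Z.of_nat i + 1 - Z.of_nat L)%Z)).
  (* On the interval [t (i+1), t i] the spline is compared with one polynomial [ref]: all its
     local coefficients either agree with those of [ref] or exceed them in the right direction. *)
  assert (Hraise : forall (i : nat) j W sg ref, (i < n)%nat ->
    (Z.of_nat i - Z.of_nat e <= j <= Z.of_nat i)%Z -> Rabs sg = 1 ->
    is_poly (S e) W -> is_poly (S e) ref ->
    (forall x, t (Z.of_nat i + 1)%Z <= x <= t (Z.of_nat i) -> Rabs (W x - ref x) <= 3 * M j) ->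
    q j = (fun x => 1 * W x + (sg * (K * M j)) * 1) ->
    M j <= sg * (c j - coef t e ref j) /\ Rabs (c j - coef t e ref j) <= (6 * Cl + 1) * M j).
  { intros i j W sg ref Hi Hj Hsg HW Href HB Eq.
    unfold c; rewrite Eq; apply coef_raised; auto; [apply HM0; unfold active; lia|].
    assert (HJ := zext_spread z n (Z.of_nat i) e Hz ltac:(lia)); fold t in HJ.
    rewrite Hrho in HJ; fold rr in HJ.
    assert (Hlt : t (Z.of_nat i + 1)%Z < t (Z.of_nat i)) by (apply Htlt; lia).
    assert (EJ : Jlen z n (Z.of_nat i + 1) = t (Z.of_nat i) - t (Z.of_nat i + 1)%Z).
    { unfold Jlen; fold t; replace (Z.of_nat i + 1 - 1)%Z with (Z.of_nat i) by lia; reflexivity. }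
    apply (HCB t _ j (t (Z.of_nat i + 1)%Z) (t (Z.of_nat i) - t (Z.of_nat i + 1)%Z)); [lra | | |].
    - apply is_poly_plus; apply is_poly_scal; assumption.
    - intros x Hx; replace (1 * W x + -1 * ref x) with (W x - ref x) by ring; apply HB; lra.
    - intros s' Hs'; rewrite EJ in HJ.
      assert (A1 : t (j + Z.of_nat s')%Z <= t (Z.of_nat i - Z.of_nat e)%Z) by (apply Ht; lia).
      assert (A2 : t (Z.of_nat i + 1 + Z.of_nat e)%Z <= t (j + Z.of_nat s')%Z)
        by (apply Ht; lia).
      assert (A3 : t (Z.of_nat i + 1 + Z.of_nat e)%Z <= t (Z.of_nat i + 1)%Z)
        by (apply Ht; lia).
      assert (A4 : t (Z.of_nat i + 1)%Z <= t (Z.of_nat i - Z.of_nat e)%Z)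
        by (apply Ht; lia).
      apply Rabs_le; lra. }
  assert (HMh : forall (i : nat) a b, (i < n)%nat ->
    (a <= Z.of_nat i + 1 + Z.of_nat L)%Z -> (Z.of_nat i + 1 - Z.of_nat L <= b)%Z ->
    t a < t b -> Mw (t a) (t b) <= Mh i).
  { intros i a b Hi Hia Hib Hab; apply HMw; auto; try apply Htb; apply Ht; assumption. }
  assert (Hmain : forall (i : nat) x, (i < n)%nat ->
    t (Z.of_nat i + 1)%Z <= x <= t (Z.of_nat i) ->
    (forall sigma, required_sign y s sigma x ->
      0 <= sigma * (db t e c e (Z.of_nat i) x - f x)) /\
    Rabs (f x - db t e c e (Z.of_nat i) x) <= (6 * Cl + 3) * Mh i).
  { intros i x Hi Hx.
    assert (Hlt : t (Z.of_nat i + 1)%Z < t (Z.of_nat i)) by (apply Htlt; lia).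
    assert (Hact : forall j, (Z.of_nat i - Z.of_nat e <= j <= Z.of_nat i)%Z -> active j)
      by (unfold active; lia).
    assert (HJw : forall j u, (Z.of_nat i - Z.of_nat e <= j <= Z.of_nat i)%Z ->
      t (Z.of_nat i + 1)%Z <= u <= t (Z.of_nat i) ->
      wlo j <= u <= whi j /\ t (j + Z.of_nat e + 1)%Z <= u <= t j).
    { intros j u Hj Hu.
      assert (A1 : wlo j <= t (Z.of_nat i + 1)%Z) by (apply Ht; lia).
      assert (A2 : t (Z.of_nat i) <= whi j) by (apply Ht; lia).
      assert (A3 : t (j + Z.of_nat e + 1)%Z <= t (Z.of_nat i + 1)%Z) by (apply Ht; lia).
      assert (A4 : t (Z.of_nat i) <= t j) by (apply Ht; lia).
      lra. }
    (* The windows of these indices reach from i + 3e + 3 to i - 3e - 2 at most, which is within 6e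
       of i + 1 because e >= 1; and 6e <= L. *)
    assert (HMj : forall j, (Z.of_nat i - Z.of_nat e <= j <= Z.of_nat i)%Z -> M j <= Mh i).
    { intros j Hj; destruct (Hwin j (Hact j Hj)) as [_ [H2 _]].
      apply HMh; [exact Hi | lia | lia | exact H2]. }
    assert (HMh0 : 0 <= Mh i).
    { apply Rle_trans with (M (Z.of_nat i)); [apply HM0, Hact | apply HMj]; lia. }
    destruct (classic (exists j0 v, (Z.of_nat i - Z.of_nat e <= j0 <= Z.of_nat i)%Z /\
      B v /\ touches t e j0 v)) as [[j0 [v [Hj0 [Hv Hj0v]]]]|Hno].
    - destruct (HPB v Hv) as [iv [Hiv [Hivt [Pref [Bref [Sref _]]]]]].
      assert (Hrange := touches_range z n e j0 v iv Hz Hiv (Hact j0 Hj0) Hj0v Hivt).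
      set (ref := PB v) in *.
      set (a := (Z.of_nat iv + Z.of_nat e + 2)%Z) in *.
      set (b := (Z.of_nat iv - Z.of_nat e - 1)%Z) in *.
      assert (Hab : t a < t b) by (apply Htlt; unfold a, b; lia).
      assert (HJv : forall u, t (Z.of_nat i + 1)%Z <= u <= t (Z.of_nat i) -> t a <= u <= t b).
      { intros u Hu.
        assert (A1 : t a <= t (Z.of_nat i + 1)%Z) by (apply Ht; unfold a; lia).
        assert (A2 : t (Z.of_nat i) <= t b) by (apply Ht; unfold b; lia).
        lra. }
      assert (Halt : forall j, (Z.of_nat i - Z.of_nat e <= j <= Z.of_nat i)%Z ->
        c j - coef t e ref j = 0 \/
        exists sg, (forall sigma, required_sign y s sigma x -> sigma = sg) /\
          M j <= sg * (c j - coef t e ref j) /\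
          Rabs (c j - coef t e ref j) <= (6 * Cl + 1) * M j).
      { intros j Hj; destruct (Hq j (Hact j Hj)) as
          [[v' [Hv' [Hjv' Eq]]]|[_ [W [sg [Hsg [HW [BW [SW Eq]]]]]]]].
        (* Two coefficients of one knot interval cannot touch different breakpoints, so this one
           comes from the reference polynomial itself. *)
        - left; rewrite <- (Hsep j0 j v v' Hv Hv' Hj0v Hjv' ltac:(lia)) in Eq.
          unfold c; rewrite Eq; fold ref; ring.
        - right; exists sg; split.
          { intros sigma Hs; apply (SW x); [now apply HJw | exact Hs]. }
          apply (Hraise i j W sg ref); auto.
          intros u Hu.
          assert (B1 := BW u (proj1 (HJw j u Hj Hu))).
          assert (B2 := Bref u (HJv u Hu)).
          assert (B3 : Mw (t a) (t b) <= M j).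
          { apply HMw; auto; try apply Htb; apply Ht; unfold a, b; lia. }
          replace (W u - ref u) with ((f u - ref u) + - (f u - W u)) by ring.
          apply Rle_trans with (1 := Rabs_triang _ _); rewrite Rabs_Ropp; lra. }
      split.
      + intros sigma Hs.
        assert (S1 : 0 <= sigma * (ref x - f x)).
        { apply Sref; [apply HJv, Hx | apply HJv, Hx | exact Hs |].
          (* Both [v] and [x] lie in the support of the B-spline [j0], hence so does any breakpoint
             between them, and it must equal [v]. *)
          intros w Hw Hwv Hbet; apply Hwv.
          apply (Hsep j0 j0 w v Hw Hv); [|exact Hj0v | lia].
          assert (Hx0 := proj2 (HJw j0 x Hj0 Hx)); unfold touches in *.
          revert Hbet; unfold Rmin, Rmax; destruct (Rle_dec v x); lra. }
        assert (S2 : 0 <= sigma * (db t e c e (Z.of_nat i) x - ref x)).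
        { apply db_ge_reference; auto.
          intros j Hj; destruct (Halt j Hj) as [E0|[sg [Esg [H1 _]]]].
          - rewrite E0; lra.
          - rewrite (Esg sigma Hs); assert (H2 := HM0 j (Hact j Hj)); lra. }
        lra.
      + replace (f x - db t e c e (Z.of_nat i) x) with
          ((f x - ref x) + - (db t e c e (Z.of_nat i) x - ref x)) by ring.
        apply Rle_trans with (1 := Rabs_triang _ _); rewrite Rabs_Ropp.
        assert (B1 := Bref x (HJv x Hx)).
        assert (B2 : Mw (t a) (t b) <= Mh i)
          by (apply HMh; [exact Hi | unfold a; lia | unfold b; lia | exact Hab]).
        assert (B3 : Rabs (db t e c e (Z.of_nat i) x - ref x) <= (6 * Cl + 1) * Mh i).
        { apply db_near_reference; auto.
          intros j Hj; destruct (Halt j Hj) as [E0|[sg [_ [_ H1]]]].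
          - rewrite E0, Rabs_R0; apply Rmult_le_pos; lra.
          - apply Rle_trans with (1 := H1), Rmult_le_compat_l; [lra | now apply HMj]. }
        lra.
    - assert (Hmid : forall j, (Z.of_nat i - Z.of_nat e <= j <= Z.of_nat i)%Z ->
        exists W sg, Rabs sg = 1 /\ is_poly (S e) W /\
        (forall u, wlo j <= u <= whi j -> Rabs (f u - W u) <= M j) /\
        (forall u sigma, t (j + Z.of_nat e + 1)%Z <= u <= t j -> required_sign y s sigma u ->
          sigma = sg) /\ q j = (fun x => 1 * W x + (sg * (K * M j)) * 1)).
      { intros j Hj; destruct (Hq j (Hact j Hj)) as [[v [Hv [Hjv _]]]|[_ H]]; [|exact H].
        exfalso; apply Hno; now exists j, v. }
      destruct (exists_argmin M (Z.of_nat i - Z.of_nat e) e) as [js [Hjs Hmin]].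
      replace (Z.of_nat i - Z.of_nat e + Z.of_nat e)%Z with (Z.of_nat i) in * by lia.
      destruct (Hmid js Hjs) as [ref [sg0 [_ [Pref [Bref [_ _]]]]]].
      assert (Halt : forall j, (Z.of_nat i - Z.of_nat e <= j <= Z.of_nat i)%Z ->
        exists sg, (forall sigma, required_sign y s sigma x -> sigma = sg) /\
          M j <= sg * (c j - coef t e ref j) /\
          Rabs (c j - coef t e ref j) <= (6 * Cl + 1) * M j).
      { intros j Hj; destruct (Hmid j Hj) as [W [sg [Hsg [HW [BW [SW Eq]]]]]].
        exists sg; split.
        { intros sigma Hs; apply (SW x); [now apply HJw | exact Hs]. }
        apply (Hraise i j W sg ref); auto.
        intros u Hu.
        assert (B1 := BW u (proj1 (HJw j u Hj Hu))).
        assert (B2 := Bref u (proj1 (HJw js u Hjs Hu))).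
        assert (B3 := Hmin j Hj); assert (B4 := HM0 j (Hact j Hj)).
        replace (W u - ref u) with ((f u - ref u) + - (f u - W u)) by ring.
        apply Rle_trans with (1 := Rabs_triang _ _); rewrite Rabs_Ropp; lra. }
      assert (B1 := Bref x (proj1 (HJw js x Hjs Hx))).
      split.
      + intros sigma Hs.
        (* This reference polynomial is not one-sided: it may err by [M js]. The surplus [M j] of
           each coefficient makes up for it, as [js] minimises [M]. *)
        assert (S2 : M js <= sigma * (db t e c e (Z.of_nat i) x - ref x)).
        { apply db_ge_reference; auto.
          intros j Hj; destruct (Halt j Hj) as [sg [Esg [H1 _]]].
          rewrite (Esg sigma Hs); assert (H2 := Hmin j Hj); lra. }
        assert (S1 : Rabs (sigma * (f x - ref x)) <= M js)
          by (rewrite Rabs_mult, (required_sign_abs _ _ _ _ Hs); lra).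
        apply Rabs_le_between in S1; lra.
      + replace (f x - db t e c e (Z.of_nat i) x) with
          ((f x - ref x) + - (db t e c e (Z.of_nat i) x - ref x)) by ring.
        apply Rle_trans with (1 := Rabs_triang _ _); rewrite Rabs_Ropp.
        assert (B2 := HMj js Hjs).
        assert (B3 : Rabs (db t e c e (Z.of_nat i) x - ref x) <= (6 * Cl + 1) * Mh i).
        { apply db_near_reference; auto.
          intros j Hj; destruct (Halt j Hj) as [sg [_ [_ H1]]].
          apply Rle_trans with (1 := H1), Rmult_le_compat_l; [lra | now apply HMj]. }
        lra. }
  destruct (spline_of_coefs e z n c He Hz) as [Sp [DS [HSig [HCr [HDS0 HDS]]]]]; fold t in HDS.
  assert (HSp : forall (i : nat) x, (i < n)%nat ->
    t (Z.of_nat i + 1)%Z <= x <= t (Z.of_nat i) -> Sp x = db t e c e (Z.of_nat i) x).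
  { intros i x Hi Hx; rewrite <- HDS0; now rewrite (HDS i 0%nat x Hi He Hx). }
  (* All coefficients of the piece containing [v] belong to B-splines touching [v], hence are those
     of [PB v], and de Boor's algorithm reproduces that polynomial. As k >= 1, r <= e and all orders
     below r are available. *)
  assert (Hint : forall v l, B v -> (l < r)%nat -> DS l v = Derive_n (PB v) l v).
  { intros v l Hv Hl.
    destruct (HPB v Hv) as [iv [Hiv [Hivt [Pref _]]]].
    rewrite (HDS iv l v Hiv ltac:(unfold e; lia) Hivt); apply Derive_n_ext; intros x.
    rewrite <- (db_reproduces t e (PB v) (Z.of_nat iv) x Pref Ht) by (apply Htlt; lia).
    apply db_ext; intros j Hj; unfold c.
    assert (Hjv : touches t e j v).
    { assert (A1 : t (j + Z.of_nat e + 1)%Z <= t (Z.of_nat iv + 1)%Z) by (apply Ht; lia).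
      assert (A2 : t (Z.of_nat iv) <= t j) by (apply Ht; lia).
      unfold touches; lra. }
    destruct (Hq j ltac:(unfold active; lia)) as [[v' [Hv' [Hjv' Eq]]]|[Hno _]].
    - rewrite Eq, (Hsep j j v' v Hv' Hv Hjv' Hjv ltac:(lia)); reflexivity.
    - exfalso; now apply (Hno v). }
  exists Sp, DS; split; [now rewrite Eke|].
  split; [replace (k + r - 2)%nat with (e - 1)%nat by (unfold e; lia); exact HCr|].
  repeat split.
  - intros i Hi x Hx.
    assert (Hx1 : -1 <= x <= 1).
    { assert (H1 := yext_le y s Hy Hys 0 i ltac:(lia)).
      assert (H2 := yext_le y s Hy Hys (S i) (S s) ltac:(lia)).
      assert (H3 : yext y s 0 = 1) by reflexivity.
      assert (H4 : yext y s (S s) = -1) by (unfold yext; simpl; now rewrite Nat.eqb_refl).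
      lra. }
    destruct (zext_locate z n x Hz Hx1) as [i0 [Hi0 Hxi]].
    rewrite (HSp i0 x Hi0 Hxi); apply (Hmain i0 x Hi0 Hxi).
    exists i; auto.
  - intros j i Hj Hi.
    assert (Hv : B (alpha j)) by (right; right; right; now exists j).
    rewrite Hint by (assumption || lia).
    destruct (HPB _ Hv) as [iv [_ [_ [_ [_ [_ [H _]]]]]]]; now apply (H j).
  - intros j i Hj Hi.
    assert (Hv : B (y j)) by (right; right; left; now exists j).
    rewrite Hint by (assumption || lia).
    destruct (HPB _ Hv) as [iv [_ [_ [_ [_ [_ [_ [H _]]]]]]]]; now apply (H j).
  - assert (Hv : B 1) by (now left); rewrite Hint by (assumption || lia).
    destruct (HPB _ Hv) as [iv [_ [_ [_ [_ [_ [_ [_ Hend]]]]]]]]; apply Hend; auto.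
  - assert (Hv : B (-1)) by (right; now left); rewrite Hint by (assumption || lia).
    destruct (HPB _ Hv) as [iv [_ [_ [_ [_ [_ [_ [_ Hend]]]]]]]]; apply Hend; auto.
  - intros i x Hi Hx L' a b; rewrite (HSp i x Hi Hx).
    apply Rle_trans with (1 := proj2 (Hmain i x Hi Hx)).
    assert (Hab : a < b) by (apply Htlt; unfold L'; fold e; fold L; lia).
    assert (Hom : 0 <= omega k (Df r) (b - a) a b).
    { apply omega_nonneg; auto; apply Htb. }
    change (Mh i) with (C0 * (b - a) ^ r * omega k (Df r) (b - a) a b).
    assert (HJ := zext_spread z n (Z.of_nat i) L Hz ltac:(lia)); fold t in HJ.
    rewrite Hrho in HJ; fold rr in HJ.
    assert (Hb : b <= t (Z.of_nat i - Z.of_nat L)%Z)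
      by (apply Ht; unfold L'; fold e; fold L; lia).
    (* The window lies within the 2L + 1 intervals centred at index i + 1; this is where the power
       of |J_i| in the estimate comes from. *)
    assert (Hlen : b - a <= spread L rr * Jlen z n (Z.of_nat i + 1)).
    { change a with (t (Z.of_nat i + 1 + Z.of_nat L)%Z); lra. }
    replace ((6 * Cl + 3) * C0 * spread L rr ^ r * Jlen z n (Z.of_nat i + 1) ^ r) with
      ((6 * Cl + 3) * (C0 * (spread L rr * Jlen z n (Z.of_nat i + 1)) ^ r))
      by (rewrite Rpow_mult_distr; ring).
    rewrite (Rmult_assoc (6 * Cl + 3)).
    apply Rmult_le_compat_l; [lra|].
    apply Rmult_le_compat_r; [exact Hom|].
    apply Rmult_le_compat_l; [exact HC0|].
    apply pow_incr; lra.
Qed.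

Theorem theorem4p10 :
  forall (k r : nat) (m1 m2 m3 : Z),
    (1 <= k)%nat ->
    ((exists j : nat, (1 <= j)%nat /\ r = (2 * j)%nat /\
        m1 = (2 * Z.of_nat j - 1)%Z /\ m2 = (2 * Z.of_nat j - 2)%Z /\
        m3 = (2 * Z.of_nat j - 1)%Z)
     \/
     (exists j : nat, r = (2 * j + 1)%nat /\
        m1 = (2 * Z.of_nat j - 1)%Z /\ m2 = (2 * Z.of_nat j)%Z /\
        m3 = (2 * Z.of_nat j)%Z)) ->
    exists c : R -> R,
    forall (s p : nat) (y alpha : nat -> R) (f : R -> R) (Df : nat -> R -> R)
           (n : nat) (z : nat -> R),
      (1 <= p)%nat ->
      (* Y_s : -1 < y_s < ... < y_1 < 1 *)
      (forall i : nat, (1 <= i <= s)%nat -> -1 < y i < 1) ->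
      (forall i : nat, (1 <= i < s)%nat -> y (S i) < y i) ->
      (* A_p : -1 <= alpha_p < ... < alpha_1 <= 1 *)
      (forall i : nat, (1 <= i <= p)%nat -> -1 <= alpha i <= 1) ->
      (forall i : nat, (1 <= i < p)%nat -> alpha (S i) < alpha i) ->
      (* Y_s and A_p are disjoint *)
      (forall i j : nat, (1 <= i <= s)%nat -> (1 <= j <= p)%nat -> y i <> alpha j) ->
      (* f in C^r[-1,1], with derivatives Df i = f^(i) on [-1,1] *)
      Cr_derivs (-1) 1 r f Df ->
      (* Z_n is a knot sequence *)
      knot_seq z n ->
      (* every nonempty open interval (beta_j, beta_{j-1}) between consecutive
         points of {-1,1} u Y_s u A_p contains >= 4(k+r-1)^2 knots *)
      (let inB (v : R) :=
         v = 1 \/ v = -1 \/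
         (exists i : nat, (1 <= i <= s)%nat /\ v = y i) \/
         (exists i : nat, (1 <= i <= p)%nat /\ v = alpha i) in
       forall a b : R, inB a -> inB b -> a < b ->
         (forall v, inB v -> ~ (a < v < b)) ->
         (4 * (k + r - 1) ^ 2 <= knots_in z n a b)%nat) ->
      exists (S : R -> R) (DS : nat -> R -> R),
        Sigma (k + r) z n S /\
        Cr_derivs (-1) 1 (k + r - 2) S DS /\
        Delta0 y s (fun x => S x - f x) /\
        (forall (j i : nat), (1 <= j <= p)%nat -> (Z.of_nat i <= m1)%Z ->
            DS i (alpha j) = Df i (alpha j)) /\
        (forall (j i : nat), (1 <= j <= s)%nat -> (Z.of_nat i <= m2)%Z ->
            DS i (y j) = Df i (y j)) /\
        (forall i : nat, (Z.of_nat i <= m3)%Z ->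
            DS i 1 = Df i 1 /\ DS i (-1) = Df i (-1)) /\
        (forall i : nat, (i <= n)%nat ->
           let iz := Z.of_nat i in
           let L := Z.of_nat (6 * (k + r - 1) ^ 2) in
           exists a b : R,
             (* J_i = [z_i, z_{i-1}] subset hatJ_i = [a,b]
                subset [z_{i+6(k+r-1)^2}, z_{i-6(k+r-1)^2}] *)
             zext z n (iz + L) <= a /\ a <= zext z n iz /\
             zext z n (iz - 1) <= b /\ b <= zext z n (iz - L) /\
             forall x : R, zext z n iz <= x <= zext z n (iz - 1) ->
               Rabs (f x - S x) <=
                 c (rho z n) * (Jlen z n iz) ^ r * omega k (Df r) (b - a) a b).
Proof.
  intros k r m1 m2 m3 Hk Hcase.
  assert (Hpar : exists r1 r2, (r1 = r \/ S r1 = r) /\ (r2 = r \/ S r2 = r) /\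
    (-1) ^ r1 = 1 /\ (-1) ^ r2 = -1 /\ (1 <= r)%nat /\
    m1 = (Z.of_nat r1 - 1)%Z /\ m2 = (Z.of_nat r2 - 1)%Z /\ m3 = (Z.of_nat r - 1)%Z).
  (* The two families of parameters say that m1 + 1 is the even one of r - 1 and r, m2 + 1 the odd
     one, and m3 + 1 = r; an order m becomes a count m + 1, so m1 = -1 is the count 0. *)
  { destruct Hcase as [[j [Hj [-> [-> [-> ->]]]]]|[j [-> [-> [-> ->]]]]].
    - exists (2 * j)%nat, (2 * (j - 1) + 1)%nat.
      rewrite pow_1_even, Nat.add_1_r, pow_1_odd; repeat split; lia.
    - exists (2 * j)%nat, (2 * j + 1)%nat.
      rewrite pow_1_even, Nat.add_1_r, pow_1_odd; repeat split; lia. }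
  destruct Hpar as [r1 [r2 [Hr1 [Hr2 [E1 [E2 [Hr [-> [-> ->]]]]]]]]].
  destruct (choice _ (fun rho0 => intertwining_spline k r r1 r2 rho0 Hk Hr Hr1 Hr2 E1 E2))
    as [c Hc].
  exists c; intros s p y alpha f Df n z _ Hy Hys Ha _ Hya Hf Hz Hknots.
  destruct (Hc (rho z n) s p y alpha f Df n z Hy Hys Ha Hya Hf Hz eq_refl Hknots)
    as [Sp [DS [HSig [HCr [HD [HA [HY [HE HB]]]]]]]].
  assert (Ht := zext_antitone z n Hz).
  exists Sp, DS; split; [exact HSig|]; split; [exact HCr|]; split; [exact HD|].
  split; [intros j i Hj Hi; apply HA; [exact Hj | lia]|].
  split; [intros j i Hj Hi; apply HY; [exact Hj | lia]|].
  split; [intros i Hi; apply HE; lia|].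
  intros i Hi iz L.
  assert (HL : (1 <= L)%Z).
  { unfold L; assert (1 <= (k + r - 1) ^ 2)%nat; [|lia].
    rewrite Nat.pow_2_r; apply Nat.mul_le_mono with (n := 1%nat) (p := 1%nat); lia. }
  (* The largest admissible interval is taken. *)
  exists (zext z n (iz + L)), (zext z n (iz - L)).
  split; [lra|]; split; [apply Ht; lia|]; split; [apply Ht; lia|]; split; [lra|].
  intros x Hx; destruct i as [|i].
  (* J_0 is reduced to the point 1 and has length 0, so the estimate demands a zero error there;
     interpolation at the endpoint supplies it. *)
  - assert (Ex : x = 1).
    { rewrite !zext_low in Hx by (assumption || (unfold iz; lia)); lra. }
    assert (EJ : Jlen z n iz = 0) by (apply Jlen_out; [exact Hz | unfold iz; lia]).
    assert (H1 : f x - Sp x = 0).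
    { subst x; destruct (HE 0%nat ltac:(lia)) as [H1 _].
      rewrite (proj1 HCr) in H1 by lra; rewrite (proj1 Hf) in H1 by lra; lra. }
    rewrite H1, Rabs_R0, EJ, pow_i by lia; lra.
  - specialize (HB i x ltac:(lia)); cbv zeta in HB.
    replace (Z.of_nat i + 1)%Z with iz in HB by (unfold iz; lia).
    replace (Z.of_nat i) with (iz - 1)%Z in HB by (unfold iz; lia).
    exact (HB Hx).
Qed.
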